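(* Let $s\ge 1$ and let $R>1$, $N>1$, $q$, $p_1,\dots,p_s$ be positive integers with $\gcd(R,N)=1$ and $p_1<p_2<\cdots<p_s<q$. Let $M=RN^q$, $D=\{0,\dots,N-1\}\oplus N^{p_1}\{0,\dots,N-1\}\oplus\cdots\oplus N^{p_s}\{0,\dots,N-1\}$, and let $\mu_{M,D}$ be the associated self-similar measure. For a real number $t$, there exists a countable set $\Lambda'\subset\mathbb{R}$ such that $\Lambda'$ and $t\Lambda'$ are both spectra of $\mu_{M,D}$ if and only if $t=\frac{t_1}{t_2}$ for some $t_1,t_2\in\mathbb{Z}$ with $\gcd(t_1,t_2)=1$ and $\gcd(t_i,N)=1$ for $i=1,2$.
   Context: $A\oplus B=\{a+b: a\in A, b\in B\}$ denotes the sumset, where all sums are distinct. The self-similar measure $\mu_{M,D}$ is the unique Borel probability measure on $\mathbb{R}$ satisfying $\mu_{M,D}(E)=\frac{1}{\#D}\sum_{d\in D}\mu_{M,D}(\tau_d^{-1}(E))$ for every Borel set $E\subset\mathbb{R}$, where $\tau_d(x)=M^{-1}(x+d)$; it is compactly supported. A countable set $\Gamma\subset\mathbb{R}$ is a spectrum of a Borel probability measure $\mu$ if $\{e^{2\pi i\gamma x}:\gamma\in\Gamma\}$ is an orthonormal basis of $L^2(\mu)$. *)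

(* Defs.v *)
From HB Require Import structures.
From mathcomp Require Import all_boot all_order all_algebra finmap.
From mathcomp Require Import all_classical all_reals all_analysis.
From mathcomp Require Import complex.

Set Implicit Arguments.
Unset Strict Implicit.
Unset Printing Implicit Defensive.
Import Order.TTheory GRing.Theory Num.Theory.
Import numFieldNormedType.Exports.

Local Open Scope classical_set_scope.
Local Open Scope ring_scope.
Local Open Scope complex_scope.

Definition digits (N : nat) : {fset nat} := [fset k | k in iota 0 N]%fset.

Definition dilate (c : nat) (A : {fset nat}) : {fset nat} :=
  [fset (c * a)%N | a in A]%fset.

Definition sumset (A B : {fset nat}) : {fset nat} :=
  [fset (a + b)%N | a in A, b in B]%fset.

(* The index i : 'I_s is 0-based: p i is p_{i+1}. That all the sums are
   distinct is lemma card_digit_set below. *)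
Definition digit_set (N s : nat) (p : 'I_s -> nat) : {fset nat} :=
  sumset (digits N)
    (\big[sumset/[fset 0%N]%fset]_(i < s) dilate (N ^ p i) (digits N)).

Lemma in_digits (N k : nat) : (k \in digits N) = (k < N)%N.
Proof. by rewrite in_fset /= mem_iota. Qed.

Lemma card_digits (N : nat) : #|` digits N| = N.
Proof. by rewrite /digits card_imfset //= undup_id ?iota_uniq ?size_iota. Qed.

Lemma card_sumset (m : nat) (A B : {fset nat}) :
  (forall a, a \in A -> (a < m)%N) -> (forall b, b \in B -> (m %| b)%N) ->
  #|` sumset A B| = (#|` A| * #|` B|)%N.
Proof.
move=> Am Bm; rewrite /sumset.
have inj a b a' b' : a \in A -> b \in B -> a' \in A -> b' \in B ->
    (a + b = a' + b')%N -> (a, b) = (a', b').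
  move=> aA bB a'A b'B e.
  have : (a + b = a' + b' %[mod m])%N by rewrite e.
  rewrite -modnDmr (eqP (Bm _ bB)) addn0 -(modnDmr a') (eqP (Bm _ b'B)) addn0.
  rewrite !modn_small ?Am // => ea; move: e; rewrite ea => /addnI ->.
  by [].
rewrite [LHS](_ : _ =
    #|` [fset (u.1 + u.2)%N | u in [seq (a, b) | a <- A, b <- B]]%fset|).
  rewrite card_in_imfset /=.
    by rewrite undup_id ?size_allpairs // allpairs_uniq ?fset_uniq // => -[? ?] [? ?].
  move=> u v /allpairsP[[a b] [/= aA bB ->]] /allpairsP[[a' b'] [/= aA' bB' ->]].
  exact: inj.
congr (#|` _|); apply/fsetP => x; apply/imfset2P/imfsetP.
  by move=> [a aA [b bB ->]]; exists (a, b) => //=; apply/allpairsP; exists (a, b).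
by move=> [u /= /allpairsP[[a b] [/= aA bB ->]] ->]; exists a => //; exists b.
Qed.

Lemma card_digit_set (N s : nat) (p : 'I_s -> nat) : (1 < N)%N ->
  (forall i, 0 < p i)%N -> (forall i j : 'I_s, (i < j)%N -> (p i < p j)%N) ->
  #|` digit_set N p| = (N ^ s.+1)%N.
Proof.
move=> N1 p0 pinc; have N0 : (0 < N)%N by exact: ltnW.
pose T s (p : 'I_s -> nat) :=
  \big[sumset/[fset 0%N]%fset]_(i < s) dilate (N ^ p i) (digits N).
suff H c : (forall i, c <= p i)%N ->
    (forall b, b \in T s p -> (N ^ c %| b)%N) /\ #|` T s p| = (N ^ s)%N.
  have [Td Tc] := H 1%N p0.
  rewrite /digit_set (@card_sumset N) ?card_digits ?Tc ?expnS //.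
  by move=> a; rewrite in_digits.
elim: s p p0 pinc c => [|s IH] p p0 pinc c pc.
  by rewrite /T big_ord0 cardfs1; split=> // b /fset1P ->; rewrite dvdn0.
rewrite /T big_ord_recl -/(T s (fun i => p (lift ord0 i))).
set B := T s _.
have [|||Bd Bc] := IH (fun i => p (lift ord0 i)) _ _ (p ord0).+1.
- by move=> i; exact: p0.
- by move=> i j ij; apply: pinc; rewrite /= /bump /= ltnS.
- by move=> i; apply: pinc.
split.
  move=> _ /imfset2P[_ /= /imfsetP[a /= _ ->] [b /Bd bd ->]].
  apply: dvdn_add; first by rewrite dvdn_mulr // dvdn_exp2l.
  by apply: dvdn_trans bd; rewrite dvdn_exp2l // ltnW // ltnS.
rewrite (@card_sumset (N ^ (p ord0).+1)) // => [|_ /imfsetP[a /= aN ->]].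
  rewrite Bc /dilate card_imfset /= ?card_digits ?expnS // => a b /eqP.
  by rewrite eqn_pmul2l ?expn_gt0 ?N0 // => /eqP.
by rewrite expnSr ltn_pmul2l ?expn_gt0 ?N0 // -in_digits.
Qed.

Section Spectral.
Context {R : realType}.

Notation borel := (measurableTypeR R).

Definition ifs_map (M d : nat) (x : R) : R := M%:R^-1 * (x + d%:R).

Definition self_similar (M : nat) (D : {fset nat})
    (mu : probability borel R) : Prop :=
  forall E : set borel, measurable E ->
    mu E = ((#|` D|%:R^-1)%:E * \sum_(d <- D) mu (ifs_map M d @^-1` E))%E.

Definition L2norm (mu : probability borel R) (f : R -> R[i]) : \bar R :=
  'N[mu]_(2%:E)[EFin \o (@ComplexField.Normc.normc R \o f)]%E.

Definition L2fun (mu : probability borel R) (f : R -> R[i]) : Prop :=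
  [/\ measurable_fun (setT : set borel) (fun x => complex.Re (f x) : borel),
      measurable_fun (setT : set borel) (fun x => complex.Im (f x) : borel)
    & (L2norm mu f < +oo)%E].

Definition L2inner (mu : probability borel R) (f g : R -> R[i]) : R[i] :=
  (\int[mu]_x complex.Re (f x * conjc (g x))) +i* (\int[mu]_x complex.Im (f x * conjc (g x))).

(* Elements of L^2(mu) are handled through representatives, so equality in
   L^2(mu) is equality almost everywhere; the last clause says that the linear
   span of the family is dense. *)
Definition orthonormal_basis (mu : probability borel R) (I : choiceType)
    (G : set I) (e : I -> R -> R[i]) : Prop :=
  [/\ forall i, G i -> L2fun mu (e i),
      forall i j, G i -> G j -> L2inner mu (e i) (e j) = (i == j)%:R
    & forall f, L2fun mu f -> forall eps : R, 0 < eps ->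
        exists (F : {fset I}) (c : I -> R[i]),
          [set` F] `<=` G /\
          (L2norm mu (fun x => (f x - \sum_(i <- F) c i * e i x)%R) < eps%:E)%E].

(* exp(2 pi i gamma x) *)
Definition expo (gamma x : R) : R[i] :=
  cos (2 * pi * gamma * x) +i* sin (2 * pi * gamma * x).

Definition spectrum (mu : probability borel R) (G : set R) : Prop :=
  countable G /\ orthonormal_basis mu G expo.

End Spectral.

(* Main.v *)
(** Let [ft] be the Fourier transform of [mu]; self-similarity gives
    [ft y = m (y / M) * ft (y / M)] where the mask [m] is a product of normalised
    geometric sums, so the zeros of [ft] are the numbers [R^k N^(qk-j-1) b] with
    [k >= 1], [j] in [{0, p_1, ..., p_s}] and [N] not dividing [b].

    Necessity: with [E = R N^(q-1-p_s)], the differences of two points of a spectrum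
    lie in [E Z], but for a prime [l | N] those with a fixed point cannot all lie in
    [l E Z], since translating that point by [E] would give a character orthogonal to
    all the others. Comparing this for [L] and [t L] shows that [l] divides neither
    the numerator nor the denominator of [t].

    Sufficiency: it is enough to find one set [L] of integers for which [t_1 L] and
    [t_2 L] are both spectra. It is grown as an [M]-adic tree whose digits
    [R * \sum_j a_j N^(q-1-j)] (with [0 <= a_j < N]) make the squared moduli of the
    truncated transforms add up to one after dilation by any integer prime to [N].
    Each new digit is corrected by a multiple of [M], so that the tails of the
    infinite product for [ft] at [t_1 l] and [t_2 l] stay bounded below: no bad zero
    can be forced, because [t_1] and [t_2] are coprime to each other and to [N], and
    compactness makes the bound uniform. The lower bound gives the Parseval identity
    in the limit, so all characters lie in the closed span of the family, and
    characters span a dense subspace of [L^2(mu)]. *)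

Require Import Defs.
From HB Require Import structures.
From mathcomp Require Import all_boot all_order all_algebra finmap.
From mathcomp Require Import all_classical all_reals all_analysis.
From mathcomp Require Import measurable_realfun complex ring lra zify.
From mathcomp Require cyclic.

Set Implicit Arguments.
Unset Strict Implicit.
Unset Printing Implicit Defensive.
Import Order.TTheory GRing.Theory Num.Theory.
Import numFieldNormedType.Exports.

Local Open Scope classical_set_scope.
Local Open Scope ring_scope.
Local Open Scope complex_scope.

(** * Characters of the real line and squared moduli of complex numbers *)

Section UnitCircle.
Context {K : realType}.
Implicit Types (x y : K) (z w : K[i]).

Definition ex x : K[i] := cos (2 * pi * x) +i* sin (2 * pi * x).

(** The squared modulus, taken in [K] rather than in [K[i]] so that it can be integrated and ordered
    without square roots. *)
Definition nsq z : K := complex.Re z ^+ 2 + complex.Im z ^+ 2.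

Lemma expoE x y : expo x y = ex (x * y).
Proof. by rewrite /expo /ex mulrA. Qed.

Lemma eqcP z w : complex.Re z = complex.Re w -> complex.Im z = complex.Im w -> z = w.
Proof. by case: z w => [a b] [c d] /= -> ->. Qed.

Lemma Re_mul z w : complex.Re (z * w) =
  complex.Re z * complex.Re w - complex.Im z * complex.Im w.
Proof. by case: z w => [a b] [c d]. Qed.

Lemma Im_mul z w : complex.Im (z * w) =
  complex.Re z * complex.Im w + complex.Im z * complex.Re w.
Proof. by case: z w => [a b] [c d]. Qed.

Lemma Re_add z w : complex.Re (z + w) = complex.Re z + complex.Re w.
Proof. by case: z w => [a b] [c d]. Qed.

Lemma Im_add z w : complex.Im (z + w) = complex.Im z + complex.Im w.
Proof. by case: z w => [a b] [c d]. Qed.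

Lemma exD x y : ex (x + y) = ex x * ex y.
Proof.
by apply: eqcP; rewrite ?Re_mul ?Im_mul /= mulrDr ?cosD ?sinD // [RHS]addrC.
Qed.

Lemma ex0 : ex 0 = 1.
Proof. by rewrite /ex mulr0 cos0 sin0. Qed.

Lemma exN x : ex (- x) = conjc (ex x).
Proof. by rewrite /ex mulrN cosN sinN. Qed.

Lemma ex1 : ex 1 = 1.
Proof. by rewrite /ex mulr1 mulr_natl cos2pi sin2pi. Qed.

Lemma exXn x n : ex (x *+ n) = ex x ^+ n.
Proof. by elim: n => [|n IH]; rewrite ?mulr0n ?ex0 ?expr0 // mulrS exD IH exprS. Qed.

Lemma ex_nat n : ex n%:R = 1.
Proof. by rewrite exXn ex1 expr1n. Qed.

Lemma ex_int (n : int) : ex n%:~R = 1.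
Proof.
case: n => n; rewrite ?NegzE ?mulrNz ?exN -pmulrn ex_nat //.
by apply: eqcP; rewrite //= oppr0.
Qed.

Lemma exDint x (n : int) : ex (x + n%:~R) = ex x.
Proof. by rewrite exD ex_int mulr1. Qed.

Lemma nsq_ge0 z : 0 <= nsq z.
Proof. by rewrite addr_ge0 ?sqr_ge0. Qed.

Lemma nsqM z w : nsq (z * w) = nsq z * nsq w.
Proof. by rewrite /nsq Re_mul Im_mul; ring. Qed.

Lemma nsq0 : nsq 0 = 0.
Proof. by rewrite /nsq expr0n addr0. Qed.

Lemma nsq1 : nsq 1 = 1.
Proof. by rewrite /nsq /= expr1n expr0n addr0. Qed.

Lemma nsq_eq0 z : nsq z = 0 -> z = 0.
Proof.
move/eqP; rewrite paddr_eq0 ?sqr_ge0 // !sqrf_eq0 => /andP[/eqP a /eqP b].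
exact: eqcP.
Qed.

Lemma nsq_conj z : nsq (conjc z) = nsq z.
Proof. by case: z => a b; rewrite /nsq /= sqrrN. Qed.

Lemma nsq_ex x : nsq (ex x) = 1.
Proof. by rewrite /nsq /= cos2Dsin2. Qed.

Lemma nsqE z : nsq z +i* 0 = z * conjc z.
Proof. by case: z => a b; apply: eqcP; rewrite /nsq ?Re_mul ?Im_mul /=; ring. Qed.

Lemma nsqD_le z w : nsq (z + w) <= 2 * nsq z + 2 * nsq w.
Proof.
case: z w => [a b] [c d]; rewrite /nsq /=.
have := sqr_ge0 (a - c); have := sqr_ge0 (b - d); nra.
Qed.

(** The fractional part [f] of [x] satisfies [cos (2 pi f) = 1 - 2 sin (pi f) ^ 2], and [sin (pi f)]
    is positive for [0 < f < 1]. *)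
Lemma ex_eq1 x : ex x = 1 -> exists n : int, x = n%:~R.
Proof.
move=> x1; exists (Num.floor x); apply/eqP; rewrite -subr_eq0; set f := _ - _.
have f0 : 0 <= f by rewrite subr_ge0 floor_le_tmp.
have f1 : f < 1 by rewrite ltrBlDl -intrD1 floorD1_gt.
have : ex f = 1 by rewrite exD x1 mul1r -mulrNz ex_int.
move=> /(congr1 (@complex.Re K)) /=; rewrite -mulrA mulr_natl cosD -!expr2.
rewrite cos2sin2 => h; rewrite eq_le f0 andbT leNgt; apply/negP => fgt0.
have : 0 < sin (pi * f).
  apply: sin_gt0_pi; rewrite mulr_gt0 ?pi_gt0 //=.
  by rewrite -[ltRHS]mulr1 ltr_pM2l // pi_gt0.
move=> /(exprn_gt0 2); lra.
Qed.

Lemma conjc_zero : conjc 0 = 0 :> K[i].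
Proof. exact: rmorph0. Qed.

Lemma conjc_one : conjc 1 = 1 :> K[i].
Proof. exact: rmorph1. Qed.

Lemma conjc_opp z : conjc (- z) = - conjc z.
Proof. exact: rmorphN. Qed.

Lemma conjc_mul z w : conjc (z * w) = conjc z * conjc w.
Proof. exact: rmorphM. Qed.

Lemma conjc_sum I (r : seq I) (F : I -> K[i]) :
  conjc (\sum_(i <- r) F i) = \sum_(i <- r) conjc (F i).
Proof. exact: rmorph_sum. Qed.

End UnitCircle.

(** * Integration of bounded complex functions *)

Section Integration.
Context {K : realType}.
Implicit Types (f g : K -> K[i]) (x y : K).

Notation mfun f := (measurable_fun (setT : set (measurableTypeR K))
  (f : measurableTypeR K -> measurableTypeR K)).

(** Boundedness makes these functions integrable for every probability measure, and the class is
    closed under sums, products and conjugation. *)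
Definition bmeas f := [/\ mfun (fun x => complex.Re (f x)),
  mfun (fun x => complex.Im (f x)) & exists C : K, forall x, nsq (f x) <= C].

Lemma bmeas_ex y : bmeas (fun x => ex (y * x)).
Proof.
split; last by exists 1 => x; rewrite nsq_ex.
  apply: continuous_measurable_fun => x /=; apply: continuous_comp.
    by do 2!(apply: continuousM; first exact: cvg_cst).
  exact: continuous_cos.
apply: continuous_measurable_fun => x /=; apply: continuous_comp.
  by do 2!(apply: continuousM; first exact: cvg_cst).
exact: continuous_sin.
Qed.

Lemma bmeas_cst (c : K[i]) : bmeas (fun=> c).
Proof. by split; [exact: measurable_cst|exact: measurable_cst|exists (nsq c)]. Qed.

Lemma bmeasD f g : bmeas f -> bmeas g -> bmeas (fun x => f x + g x).
Proof.
move=> [f1 f2 [C fC]] [g1 g2 [D gD]]; split.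
- by under eq_fun do rewrite Re_add; exact: measurable_funD.
- by under eq_fun do rewrite Im_add; exact: measurable_funD.
- exists (2 * C + 2 * D) => x; apply: (le_trans (nsqD_le _ _)).
  by rewrite lerD // ler_pM2l.
Qed.

Lemma bmeasM f g : bmeas f -> bmeas g -> bmeas (fun x => f x * g x).
Proof.
move=> [f1 f2 [C fC]] [g1 g2 [D gD]]; split.
- by under eq_fun do rewrite Re_mul; apply: measurable_funB; exact: measurable_funM.
- by under eq_fun do rewrite Im_mul; apply: measurable_funD; exact: measurable_funM.
- by exists (C * D) => x; rewrite nsqM ler_pM ?nsq_ge0.
Qed.

Lemma bmeas_conj f : bmeas f -> bmeas (fun x => conjc (f x)).
Proof.
move=> [f1 f2 [C fC]]; split; last by exists C => x; rewrite nsq_conj.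
  by apply: eq_measurable_fun f1 => x _; case: (f x).
rewrite (_ : (fun x => _) = (fun x => - complex.Im (f x))); last first.
  by apply/funext => x; case: (f x).
exact: measurable_funN.
Qed.

Lemma bmeas_sum I (r : seq I) (F : I -> K -> K[i]) :
  (forall i, bmeas (F i)) -> bmeas (fun x => \sum_(i <- r) F i x).
Proof.
move=> bF; elim: r => [|i r IH].
  by under eq_fun do rewrite big_nil; exact: bmeas_cst.
by under eq_fun do rewrite big_cons; exact: bmeasD.
Qed.

Variable mu : probability (measurableTypeR K) K.

Definition Cint f : K[i] :=
  (\int[mu]_x complex.Re (f x)) +i* (\int[mu]_x complex.Im (f x)).

(** The squared [L^2] norm, possibly infinite; [L2norm_sqr] links it to [L2norm]. *)
Definition E2 f : \bar K := (\int[mu]_x (nsq (f x))%:E)%E.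

Lemma integrable_bounded (h : K -> K) (C : K) : mfun h ->
  (forall x, `|h x| <= C) -> mu.-integrable setT (EFin \o h).
Proof.
move=> mh hC; apply: measurable_bounded_integrable => //.
  by rewrite (le_lt_trans (probability_le1 _ _)) ?ltry.
exists C; split; first exact: num_real.
by move=> D CD x _; rewrite /= (le_trans (hC x)) // ltW.
Qed.

Lemma normr_Re_le (z : K[i]) : `|complex.Re z| <= Num.sqrt (nsq z).
Proof. by rewrite -sqrtr_sqr ler_wsqrtr // lerDl sqr_ge0. Qed.

Lemma normr_Im_le (z : K[i]) : `|complex.Im z| <= Num.sqrt (nsq z).
Proof. by rewrite -sqrtr_sqr ler_wsqrtr // lerDr sqr_ge0. Qed.

Lemma integrable_Re f : bmeas f -> mu.-integrable setT (EFin \o (fun x => complex.Re (f x))).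
Proof.
move=> [f1 _ [C fC]]; apply: (@integrable_bounded _ (Num.sqrt C)) => // x.
by rewrite (le_trans (normr_Re_le _)) ?ler_wsqrtr.
Qed.

Lemma integrable_Im f : bmeas f -> mu.-integrable setT (EFin \o (fun x => complex.Im (f x))).
Proof.
move=> [_ f2 [C fC]]; apply: (@integrable_bounded _ (Num.sqrt C)) => // x.
by rewrite (le_trans (normr_Im_le _)) ?ler_wsqrtr.
Qed.

Lemma CintD f g : bmeas f -> bmeas g ->
  Cint (fun x => f x + g x) = Cint f + Cint g.
Proof.
move=> bf bg; apply: eqcP; rewrite ?Re_add ?Im_add /=.
  under eq_Rintegral do rewrite Re_add.
  by apply: RintegralD => //; exact: integrable_Re.
under eq_Rintegral do rewrite Im_add.
by apply: RintegralD => //; exact: integrable_Im.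
Qed.

Lemma CintZ (c : K[i]) f : bmeas f -> Cint (fun x => c * f x) = c * Cint f.
Proof.
move=> bf; have iR := integrable_Re bf; have iI := integrable_Im bf.
have iZ (a : K) (h : K -> K) : mu.-integrable setT (EFin \o h) ->
  mu.-integrable setT (EFin \o (fun x => a * h x)).
  move=> ih; apply: eq_integrable (integrableZl measurableT a ih) => //.
apply: eqcP; rewrite ?Re_mul ?Im_mul /=.
  under eq_Rintegral do rewrite Re_mul.
  by rewrite RintegralB ?RintegralZl //; exact: iZ.
under eq_Rintegral do rewrite Im_mul.
by rewrite RintegralD ?RintegralZl //; exact: iZ.
Qed.

Lemma Cint_cst (c : K[i]) : Cint (fun=> c) = c.
Proof.
have m1 : fine (mu setT) = 1 by rewrite probability_setT.
by apply: eqcP; rewrite /= Rintegral_cst // m1 mulr1.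
Qed.

Lemma Cint_sum I (r : seq I) (F : I -> K -> K[i]) :
  (forall i, bmeas (F i)) ->
  Cint (fun x => \sum_(i <- r) F i x) = \sum_(i <- r) Cint (F i).
Proof.
move=> bF; elim: r => [|i r IH].
  by under eq_fun do rewrite big_nil; rewrite big_nil Cint_cst.
under eq_fun do rewrite big_cons.
by rewrite big_cons CintD ?IH //; exact: bmeas_sum.
Qed.

Lemma Cint_conj f : bmeas f -> Cint (fun x => conjc (f x)) = conjc (Cint f).
Proof.
move=> bf; apply: eqcP => /=; first by apply: eq_Rintegral => x _; case: (f x).
rewrite -[RHS]mulN1r -RintegralZl //; last exact: integrable_Im.
by apply: eq_Rintegral => x _; rewrite mulN1r; case: (f x).
Qed.

Lemma E2_bmeas f : bmeas f -> E2 f = (complex.Re (Cint (fun x => f x * conjc (f x))))%:E.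
Proof.
move=> bf; rewrite /Cint /= fineK.
  by apply: eq_integral => x _; rewrite -nsqE.
apply: integrable_fin_num => //.
exact: (integrable_Re (bmeasM bf (bmeas_conj bf))).
Qed.

End Integration.

(** * The Fourier transform of a measure, orthogonality and Bessel's inequality *)

Section FourierTransform.
Context {K : realType}.
Variable mu : probability (measurableTypeR K) K.
Implicit Types (x y : K) (r : seq (K[i] * K)).

Local Arguments conjc : simpl never.

Definition ft y : K[i] := Cint mu (fun x => ex (y * x)).

(** Frequencies may repeat in [r], so that concatenation of lists is addition; [trigpoly_collect]
    merges the repetitions. *)
Definition trigpoly r x : K[i] := \sum_(p <- r) p.1 * ex (p.2 * x).

Lemma ft0 : ft 0 = 1.
Proof.
rewrite /ft (_ : (fun x => _) = (fun=> 1)) ?Cint_cst //.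
by apply/funext => x; rewrite mul0r ex0.
Qed.

Lemma ftN y : ft (- y) = conjc (ft y).
Proof.
rewrite /ft -Cint_conj; last exact: bmeas_ex.
by congr (Cint mu _); apply/funext => x; rewrite mulNr exN.
Qed.

Lemma bmeas_trigpoly r : bmeas (trigpoly r).
Proof.
by apply: bmeas_sum => p; apply: bmeasM (bmeas_ex _); exact: bmeas_cst.
Qed.

Lemma E2_trigpoly r : E2 mu (trigpoly r) =
  (complex.Re (\sum_(p <- r) \sum_(q <- r) p.1 * conjc q.1 * ft (p.2 - q.2)))%:E.
Proof.
rewrite E2_bmeas; last exact: bmeas_trigpoly.
have bZ (c : K[i]) y : bmeas (fun x => c * ex (y * x)).
  by apply: bmeasM (bmeas_ex _); exact: bmeas_cst.
congr (complex.Re _)%:E; rewrite (_ : (fun x => _) = fun x => \sum_(p <- r) \sum_(q <- r)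
    p.1 * conjc q.1 * ex ((p.2 - q.2) * x)); last first.
  apply/funext => x; rewrite /trigpoly conjc_sum mulr_suml.
  apply: eq_bigr => p _; rewrite mulr_sumr; apply: eq_bigr => q _.
  by rewrite mulrBl exD exN conjc_mul; ring.
rewrite Cint_sum => [|p]; last exact: bmeas_sum.
apply: eq_bigr => p _; rewrite Cint_sum //; apply: eq_bigr => q _.
by rewrite CintZ //; exact: bmeas_ex.
Qed.

Lemma E2_ge0 (f : K -> K[i]) : (0 <= E2 mu f)%E.
Proof. by apply: integral_ge0 => x _; rewrite lee_fin nsq_ge0. Qed.

Lemma L2inner_expo x y : L2inner mu (expo x) (expo y) = ft (x - y).
Proof.
rewrite -[LHS]/(Cint mu (fun z => expo x z * conjc (expo y z))).
by congr (Cint mu _); apply/funext => z; rewrite !expoE mulrBl exD exN.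
Qed.

(** Pythagoras: the character of frequency [y] has norm 1 and is orthogonal to the rest of the
    sum. *)
Lemma E2_cons y r : (forall p, p \in r -> ft (y - p.2) = 0) ->
  (1 <= E2 mu (trigpoly ((1%R, y) :: r)))%E.
Proof.
move=> yr; rewrite E2_trigpoly !big_cons conjc_one /= subrr ft0 !mul1r.
rewrite big_seq big1 => [|p /yr ->]; last by rewrite mulr0.
under [X in _ + _ + X]eq_bigr do rewrite big_cons.
rewrite big_split /= [X in _ + (X + _)]big_seq [X in _ + (X + _)]big1 => [|p /yr e]; last first.
  by rewrite -opprB ftN e conjc_zero mulr0.
rewrite add0r addr0 Re_add EFinD -E2_trigpoly /=.
by rewrite -[leLHS]adde0 leeD2l // E2_ge0.
Qed.

(** When the characters with frequencies in [L] are orthonormal, this is the character of frequency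
    [y] minus its orthogonal projection on their span. *)
Definition residual y (L : seq K) := (1, y) :: [seq (- ft (y - l), l) | l <- L].

(** In the double sum of [E2_trigpoly], the row of [y] already gives the right-hand side. The row of
    each [l] in [L] vanishes, since only its columns [y] and [l] survive and they cancel. *)
Lemma E2_residual y (L : seq K) : uniq L ->
  {in L &, forall a b, a != b -> ft (a - b) = 0} ->
  E2 mu (trigpoly (residual y L)) = (1 - \sum_(l <- L) nsq (ft (y - l)))%:E.
Proof.
move=> uL oL; rewrite E2_trigpoly; set S := \sum_(l <- L) _; congr _%:E.
suff -> : \sum_(p <- residual y L) \sum_(q <- residual y L)
  p.1 * conjc q.1 * ft (p.2 - q.2) = (1 - S) +i* 0 by [].
have SE : S +i* 0 = \sum_(l <- L) ft (y - l) * conjc (ft (y - l)).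
  rewrite /S; elim: (L) => [|l r IH]; first by rewrite !big_nil.
  by rewrite !big_cons -IH -nsqE; apply: eqcP; rewrite ?Re_add ?Im_add //= addr0.
have S1 : (1 - S) +i* 0 = 1 - (S +i* 0) by apply: eqcP; rewrite //= subr0.
rewrite /residual !big_cons !big_map conjc_one /= subrr ft0 !mul1r S1 SE.
under [X in 1 + X + _]eq_bigr do rewrite mul1r conjc_opp mulNr mulrC.
rewrite sumrN -[RHS]addr0; congr (_ + _).
rewrite big_seq big1 // => l lL; rewrite big_cons big_map conjc_one /= mulr1.
rewrite (bigD1_seq l) //= subrr ft0 mulr1 big1_seq => [|k /andP[kl kL]]; last first.
  by rewrite [ft (l - k)]oL ?mulr0 //; rewrite eq_sym.
by rewrite -(opprB y) ftN conjc_opp addr0; ring.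
Qed.

Lemma bessel y (L : seq K) : uniq L ->
  {in L &, forall a b, a != b -> ft (a - b) = 0} ->
  \sum_(l <- L) nsq (ft (y - l)) <= 1.
Proof.
move=> uL oL; have := E2_ge0 (trigpoly (residual y L)).
by rewrite E2_residual // lee_fin subr_ge0.
Qed.

(** Bessel's inequality for the single frequency 0. *)
Lemma nsq_ft_le1 y : nsq (ft y) <= 1.
Proof.
have := @bessel y [:: 0]; rewrite big_seq1 subr0; apply=> // a b.
by rewrite !inE => /eqP -> /eqP ->; rewrite eqxx.
Qed.

Lemma L2norm_sqr (f : K -> K[i]) : (L2norm mu f `^ 2 = E2 mu f)%E.
Proof.
rewrite /L2norm poweR_Lnorm //; apply: eq_integral => x _ /=.
case: (f x) => a b; rewrite /nsq /= powR_mulrn ?normr_ge0 //.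
by rewrite ger0_norm ?sqrtr_ge0 // sqr_sqrtr // addr_ge0 ?sqr_ge0.
Qed.

Lemma L2norm_ltP (f : K -> K[i]) (eps : K) : 0 < eps ->
  (L2norm mu f < eps%:E)%E = (E2 mu f < (eps ^+ 2)%:E)%E.
Proof.
move=> e0; have := L2norm_sqr f.
have : (0 <= L2norm mu f)%E := Lnorm_ge0 _ _ _.
case: (L2norm mu f) => [a|_ <-|//].
  rewrite lee_fin => a0 <-; rewrite poweR_EFin powR_mulrn // !lte_fin.
  by rewrite ltr_pXn2r ?nnegrE // ltW.
by rewrite poweRyr.
Qed.

Lemma L2norm_ltyP (f : K -> K[i]) : (L2norm mu f < +oo)%E = (E2 mu f < +oo)%E.
Proof.
have := L2norm_sqr f.
have : (0 <= L2norm mu f)%E := Lnorm_ge0 _ _ _.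
case: (L2norm mu f) => [a|_ <-|//]; last by rewrite poweRyr.
by rewrite poweR_EFin => _ <-; rewrite !ltry.
Qed.

End FourierTransform.

(** * The mask of the digit set as a product of normalised geometric sums *)

Section MaskPolynomial.
Context {K : realType}.
Implicit Types (x y : K) (N M c : nat) (A B : {fset nat}) (P : seq nat).

(** In the convention of [ft], the Fourier transform of the uniform measure on the integers from 0
    to [N - 1]. *)
Definition unit_mask N x : K[i] := N%:R^-1 * \sum_(k < N) ex (k%:R * x).

Definition mask_poly N P x : K[i] := \prod_(j <- P) unit_mask N ((N ^ j)%:R * x).

(** The cardinality hypothesis says that all sums are distinct, so the sumset is a permutation of
    the list of all sums. *)
Lemma sum_sumset A B (F : nat -> K[i]) :
  #|` sumset A B| = (#|` A| * #|` B|)%N ->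
  \sum_(d <- sumset A B) F d = \sum_(a <- A) \sum_(b <- B) F (a + b)%N.
Proof.
move=> cardAB; rewrite -(big_allpairs_dep (h := fun a b => (a + b)%N)).
have memAB : sumset A B =i [seq (a + b)%N | a <- A, b <- B].
  move=> d; apply/imfset2P/allpairsP => [[a aA [b bB ->]]|[[a b] [/= aA bB ->]]].
    by exists (a, b).
  by exists a => //; exists b.
apply: perm_big; apply: uniq_perm; [exact: fset_uniq| |exact: memAB].
apply: (@leq_size_uniq _ (sumset A B)); first exact: fset_uniq.
  by move=> d; rewrite memAB.
by rewrite size_allpairs -cardAB.
Qed.

Lemma sum_digits N (F : nat -> K[i]) : \sum_(d <- digits N) F d = \sum_(k < N) F k.
Proof.
rewrite -(big_mkord xpredT F) /index_iota subn0; apply: perm_big.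
by apply: uniq_perm; rewrite ?fset_uniq ?iota_uniq // => k; rewrite in_digits mem_iota.
Qed.

Lemma sum_dilate c A (F : nat -> K[i]) : (0 < c)%N ->
  \sum_(d <- dilate c A) F d = \sum_(a <- A) F (c * a)%N.
Proof.
move=> c0; rewrite -[RHS](big_map (fun a => (c * a)%N) xpredT).
apply: perm_big; apply: uniq_perm; first exact: fset_uniq.
  rewrite map_inj_uniq ?fset_uniq // => a b /eqP.
  by rewrite eqn_pmul2l // => /eqP.
by move=> d; apply/imfsetP/mapP => -[a aA ->]; exists a.
Qed.

Lemma sum_digits_ex N x : (0 < N)%N ->
  \sum_(k < N) ex (k%:R * x) = N%:R * unit_mask N x.
Proof. by move=> N0; rewrite mulVKf // pnatr_eq0 -lt0n. Qed.

Lemma sum_digit_set N s (p : 'I_s -> nat) x : (1 < N)%N ->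
  (forall i, 0 < p i)%N -> (forall i j : 'I_s, (i < j)%N -> (p i < p j)%N) ->
  \sum_(d <- digit_set N p) ex (d%:R * x) = N%:R ^+ s.+1 * mask_poly N (0%N :: codom p) x.
Proof.
move=> N1 p0 pinc; have N0 : (0 < N)%N by exact: ltnW.
pose T s (p : 'I_s -> nat) :=
  \big[sumset/[fset 0%N]%fset]_(i < s) dilate (N ^ p i) (digits N).
(* The induction also carries the divisibility of the tail by [N ^ c]. For [c = (p ord0).+1] this
   power exceeds every element of the leading block, so the sums of block and tail are distinct. *)
suff H c : (forall i, c <= p i)%N -> [/\ forall b, b \in T s p -> (N ^ c %| b)%N,
    #|` T s p| = (N ^ s)%N & \sum_(d <- T s p) ex (d%:R * x) =
      N%:R ^+ s * mask_poly N (codom p) x].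
  have [Td Tc Ts] := H 1%N p0.
  rewrite /digit_set sum_sumset; last first.
    rewrite (@card_sumset N) // => a; by rewrite in_digits.
  under eq_bigr do under eq_bigr do rewrite natrD mulrDl exD.
  under eq_bigr do rewrite -mulr_sumr.
  rewrite -mulr_suml Ts sum_digits sum_digits_ex // /mask_poly big_cons expn0 mul1r.
  by rewrite exprS; ring.
elim: s p p0 pinc c => [|s IH] p p0 pinc c pc.
  rewrite /T big_ord0 cardfs1; split=> //; first by move=> b /fset1P ->; rewrite dvdn0.
  rewrite big_seq_fset1 mul0r ex0 /mask_poly big_map big_enum big_ord0.
  by rewrite expr0 mulr1.
rewrite /T big_ord_recl -/(T s (fun i => p (lift ord0 i))).
set B := T s _.
have [|||Bd Bc Bs] := IH (fun i => p (lift ord0 i)) _ _ (p ord0).+1.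
- by move=> i; exact: p0.
- by move=> i j ij; apply: pinc; rewrite /= /bump /= ltnS.
- by move=> i; apply: pinc.
have card : #|` sumset (dilate (N ^ p ord0) (digits N)) B| = (N * N ^ s)%N.
  rewrite (@card_sumset (N ^ (p ord0).+1)) // => [|_ /imfsetP[a /= aN ->]].
    rewrite Bc /dilate card_imfset /= ?card_digits // => a b /eqP.
    by rewrite eqn_pmul2l ?expn_gt0 ?N0 // => /eqP.
  by rewrite expnSr ltn_pmul2l ?expn_gt0 ?N0 // -in_digits.
split; last first.
- rewrite sum_sumset; last first.
    rewrite card Bc /dilate card_imfset /= ?card_digits // => a b /eqP.
    by rewrite eqn_pmul2l ?expn_gt0 ?N0 // => /eqP.
  rewrite sum_dilate ?expn_gt0 ?N0 //.
  under eq_bigr do under eq_bigr do rewrite natrD mulrDl exD.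
  under eq_bigr do rewrite -mulr_sumr natrM [_ * _%:R]mulrC -mulrA.
  rewrite -mulr_suml Bs sum_digits sum_digits_ex //.
  rewrite exprS (_ : mask_poly N (codom p) x = unit_mask N ((N ^ p ord0)%:R * x) *
    mask_poly N (codom (fun i => p (lift ord0 i))) x); first by ring.
  by rewrite /mask_poly /codom /image_mem !big_map -!enumT big_enum big_ord_recl big_enum.
- by rewrite card expnS.
move=> _ /imfset2P[_ /= /imfsetP[a /= _ ->] [b /Bd bd ->]].
apply: dvdn_add; first by rewrite dvdn_mulr // dvdn_exp2l.
by apply: dvdn_trans bd; rewrite dvdn_exp2l // ltnW // ltnS.
Qed.

End MaskPolynomial.

(** * Self-similarity, from sets to integrals and to the Fourier transform *)

Section SelfSimilar.
Context {K : realType}.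
Variables (M : nat) (D : {fset nat}) (mu : probability (measurableTypeR K) K).
Hypotheses (D0 : (0 < #|` D|)%N) (muMD : self_similar M D mu).

Lemma measurable_ifs_map d : measurable_fun (setT : set (measurableTypeR K))
  (ifs_map M d : measurableTypeR K -> measurableTypeR K).
Proof.
apply: measurable_funM; first exact: measurable_cst.
by apply: measurable_funD; [exact: measurable_id|exact: measurable_cst].
Qed.

Definition ifs_mfun d : {mfun measurableTypeR K >-> measurableTypeR K} :=
  HB.pack (ifs_map M d : measurableTypeR K -> measurableTypeR K)
    (isMeasurableFun.Build _ _ _ _ _ (measurable_ifs_map d)).

(** [self_similar] makes [mu] the average of its images under the maps [ifs_map M d]. Writing that
    average as a scaled finite sum of pushforward measures carries the identity over to
    integrals. *)
Lemma ge0_integral_self_similar (h : measurableTypeR K -> \bar K) :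
  measurable_fun setT h -> (forall x, 0 <= h x)%E ->
  (\int[mu]_x h x =
   (#|` D|%:R^-1)%:E * \sum_(d <- D) \int[mu]_x h (ifs_map M d x))%E.
Proof.
move=> mh h0.
have c0 : (0 <= #|` D|%:R^-1 :> K) by rewrite invr_ge0.
pose nu n := distribution mu (ifs_mfun (nth 0%N D n)).
rewrite (@eq_measure_integral _ _ _ _ (mscale (NngNum c0) (msum nu #|` D|))) => [|A mA _].
  rewrite ge0_integral_mscale // ge0_integral_measure_sum //.
  rewrite (big_nth 0%N) big_mkord; congr (_ * _)%E; apply: eq_bigr => n _.
  by rewrite ge0_integral_distribution.
rewrite [LHS](muMD mA) /mscale /= /msum (big_nth 0%N) big_mkord.
by congr (_ * _)%E; apply: eq_bigr.
Qed.

Lemma Rintegral_self_similar (h : K -> K) (C : K) :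
  measurable_fun (setT : set (measurableTypeR K)) (h : measurableTypeR K -> measurableTypeR K) ->
  (forall x, `|h x| <= C) ->
  \int[mu]_x h x = #|` D|%:R^-1 * \sum_(d <- D) \int[mu]_x h (ifs_map M d x).
Proof.
move=> mh hC.
have mi d : measurable_fun (setT : set (measurableTypeR K))
    ((fun x => h (ifs_map M d x)) : measurableTypeR K -> measurableTypeR K).
  exact: (measurableT_comp mh (measurable_ifs_map d)).
have m1 : fine (mu setT) = 1 by rewrite probability_setT.
have shift (g : K -> K) :
    measurable_fun (setT : set (measurableTypeR K)) (g : measurableTypeR K -> measurableTypeR K) ->
    (forall x, `|g x| <= C) ->
    (\int[mu]_x (g x + C)%:E)%E = (\int[mu]_x g x + C)%:E.
  move=> mg gC; have ig := integrable_bounded mu mg gC.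
  have iC : mu.-integrable setT (EFin \o (fun=> C)).
    by apply: (@integrable_bounded _ _ _ `|C|) => //; exact: measurable_cst.
  rewrite -[X in _ = (_ + X)%:E](_ : \int[mu]_x C = C); last by rewrite Rintegral_cst // m1 mulr1.
  rewrite -RintegralD // fineK //; apply: integrable_fin_num => //.
  by apply: eq_integrable (integrableD measurableT ig iC).
(* Adding the bound [C] makes the integrand nonnegative; the averaging weights sum to 1, so [C]
   cancels at the end. *)
have := @ge0_integral_self_similar (fun x => (h x + C)%:E).
rewrite shift // (eq_bigr (fun d => (\int[mu]_x h (ifs_map M d x) + C)%:E)) => [|d _]; last first.
  by rewrite shift.
rewrite sumEFin -EFinM => H.
have [] : (\int[mu]_x h x + C)%:E = (#|` D|%:R^-1 *
    \sum_(d <- D) (\int[mu]_x h (ifs_map M d x) + C))%:E.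
  apply: H => [|x].
    apply/measurable_EFinP; apply: measurable_funD => //; exact: measurable_cst.
  by rewrite lee_fin -lerBlDr sub0r; have := hC x; rewrite ler_norml => /andP[].
rewrite big_split /= mulrDr big_const_seq count_predT iter_addr_0.
by rewrite -[C *+ _]mulr_natl mulKf ?pnatr_eq0 -?lt0n // => /addIr.
Qed.

Lemma Cint_self_similar (f : K -> K[i]) : bmeas f ->
  Cint mu f = #|` D|%:R^-1 * \sum_(d <- D) Cint mu (fun x => f (ifs_map M d x)).
Proof.
move=> [f1 f2 [C fC]].
have cE : #|` D|%:R^-1 = (#|` D|%:R^-1 : K) +i* 0 :> K[i].
  apply: (@mulfI _ #|` D|%:R); rewrite ?pnatr_eq0 -?lt0n // mulfV ?pnatr_eq0 -?lt0n //.
  have -> n : n%:R = (n%:R : K) +i* 0 :> K[i].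
    by elim: n => [|n IH]; rewrite // -!natr1 IH; apply: eqcP; rewrite //= addr0.
  by apply: eqcP; rewrite ?Re_mul ?Im_mul /= ?mulfV ?pnatr_eq0 -?lt0n //; ring.
have ReS (F : nat -> K[i]) (r : seq nat) :
    complex.Re (\sum_(d <- r) F d) = \sum_(d <- r) complex.Re (F d).
  by elim: r => [|d r IH]; rewrite ?big_nil // !big_cons Re_add IH.
have ImS (F : nat -> K[i]) (r : seq nat) :
    complex.Im (\sum_(d <- r) F d) = \sum_(d <- r) complex.Im (F d).
  by elim: r => [|d r IH]; rewrite ?big_nil // !big_cons Im_add IH.
have C1 x := le_trans (normr_Re_le (f x)) (ler_wsqrtr (fC x)).
have C2 x := le_trans (normr_Im_le (f x)) (ler_wsqrtr (fC x)).
rewrite cE; apply: eqcP; rewrite ?Re_mul ?Im_mul ?ReS ?ImS /= mul0r ?subr0 ?addr0.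
  exact: Rintegral_self_similar C1.
exact: Rintegral_self_similar C2.
Qed.

(** Composition with [ifs_map M d] turns the character of frequency [y] into a phase times the
    character of frequency [y / M]. *)
Lemma ft_self_similar y : ft mu y =
  #|` D|%:R^-1 * (\sum_(d <- D) ex (d%:R * (y / M%:R))) * ft mu (y / M%:R).
Proof.
rewrite {1}/ft Cint_self_similar; last exact: bmeas_ex.
rewrite -mulrA mulr_suml; congr (_ * _); apply: eq_bigr => d _.
rewrite /ft -CintZ; last exact: bmeas_ex.
congr (Cint mu _); apply/funext => x; rewrite -exD /ifs_map; congr ex; ring.
Qed.

End SelfSimilar.

(** * Spectra expressed through the Fourier transform *)

Section Spectra.
Context {K : realType}.
Variable mu : probability (measurableTypeR K) K.
Implicit Types (x y l : K) (L : set K) (r : seq (K[i] * K)).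

Lemma cvg_Rintegral_bounded (f : nat -> K -> K) (g : K -> K) (C : K) :
  (forall n, measurable_fun (setT : set (measurableTypeR K))
    (f n : measurableTypeR K -> measurableTypeR K)) ->
  measurable_fun (setT : set (measurableTypeR K)) (g : measurableTypeR K -> measurableTypeR K) ->
  (forall x, f n x @[n --> \oo] --> g x) -> (forall n x, `|f n x| <= C) ->
  \int[mu]_x f n x @[n --> \oo] --> \int[mu]_x g x.
Proof.
move=> mf mg fg fC.
have iC : mu.-integrable setT (EFin \o (fun=> C)).
  apply: (@integrable_bounded _ _ _ `|C|) => //; exact: measurable_cst.
have [|||||ig _ cvg] := @dominated_convergence _ _ _ mu setT measurableT
    (fun n x => (f n x)%:E) (fun x => (g x)%:E) (EFin \o (fun=> C)).
- by move=> n; apply/measurable_EFinP; exact: mf.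
- by apply/measurable_EFinP.
- by apply: aeW => x _; apply: cvg_EFin; [exact: nearW|exact: fg].
- exact: iC.
- by apply: aeW => x n _; rewrite lee_fin.
apply: fine_cvg; rewrite fineK //; exact: integrable_fin_num.
Qed.

(** Sequential continuity by dominated convergence, the integrands being bounded by 1. *)
Lemma continuous_nsq_ft : continuous (fun y => nsq (ft mu y)).
Proof.
move=> y; apply/(@cvg_nbhsP _ K^o) => u uy.
have uyx x : 2 * pi * (u n * x) @[n --> \oo] --> 2 * pi * (y * x).
  by apply: cvgMr; apply: cvgMl.
have bu (z : K) := bmeas_ex z.
have cRe : complex.Re (ft mu (u n)) @[n --> \oo] --> complex.Re (ft mu y).
  apply: (@cvg_Rintegral_bounded _ _ 1) => [n||x|n x].
  - by have [] := bu (u n).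
  - by have [] := bu y.
  - exact: (cvg_comp _ _ (uyx x) (@continuous_cos K _)).
  - by rewrite -[leRHS]sqrtr1 -(nsq_ex (u n * x)) normr_Re_le.
have cIm : complex.Im (ft mu (u n)) @[n --> \oo] --> complex.Im (ft mu y).
  apply: (@cvg_Rintegral_bounded _ _ 1) => [n||x|n x].
  - by have [] := bu (u n).
  - by have [] := bu y.
  - exact: (cvg_comp _ _ (uyx x) (@continuous_sin K _)).
  - by rewrite -[leRHS]sqrtr1 -(nsq_ex (u n * x)) normr_Im_le.
by rewrite /nsq; apply: cvgD; apply: cvgM.
Qed.

Lemma spectrum_orthogonal L a b : spectrum mu L -> L a -> L b -> a != b ->
  ft mu (a - b) = 0.
Proof.
move=> [_ [_ oL _]] La Lb ab.
by rewrite -L2inner_expo oL // (negbTE ab).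
Qed.

Lemma bmeas_E2_lty f : bmeas f -> (E2 mu f < +oo)%E.
Proof. by move=> bf; rewrite E2_bmeas // ltry. Qed.

Lemma expo_L2fun x : L2fun mu (expo x).
Proof.
have [f1 f2 _] := bmeas_ex x; have -> : expo x = fun z => ex (x * z).
  by apply/funext => z; rewrite expoE.
split=> //; rewrite L2norm_ltyP; apply: bmeas_E2_lty; exact: bmeas_ex.
Qed.

(** A character orthogonal to the whole family would be at distance at least 1 from every finite
    combination, by [E2_cons], which contradicts density. *)
Lemma spectrum_maximal L x : spectrum mu L ->
  exists2 l, L l & ft mu (x - l) != 0.
Proof.
move=> [_ [_ _ dL]]; apply/not_exists2P => H.
have [F [c [FL]]] := dL _ (expo_L2fun x) 1 ltr01.
rewrite L2norm_ltP // expr1n ltNge => /negP; apply.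
have := @E2_cons _ mu x [seq (- c i, i) | i <- F].
rewrite (_ : trigpoly _ = fun z => expo x z - \sum_(i <- F) c i * expo i z); last first.
  apply/funext => z; rewrite /trigpoly big_cons big_map mul1r expoE; congr (_ + _).
  by rewrite -sumrN; apply: eq_bigr => i _; rewrite expoE mulNr.
apply=> p /mapP[l lF ->] /=.
by have [/(_ (FL _ lF))|/negP/negPn/eqP] := H l.
Qed.

(** [orthonormal_basis] asks for one coefficient per element of a finite set, so the coefficients of
    a repeated frequency are added up. *)
Lemma trigpoly_collect r : trigpoly r =
  fun x => \sum_(l <- [fset p.2 | p in r]%fset)
    (\sum_(p <- r | p.2 == l) p.1) * expo l x.
Proof.
apply/funext => x; rewrite /trigpoly.
under [RHS]eq_bigr do rewrite mulr_suml big_mkcond.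
rewrite exchange_big /=; apply: eq_big_seq => p pr.
rewrite (bigD1_seq p.2) ?fset_uniq //=; last by apply/imfsetP; exists p.
rewrite eqxx big1 => [|l pl]; first by rewrite addr0 expoE.
by rewrite eq_sym (negbTE pl).
Qed.

Lemma spectrum_intro L : countable L ->
  (forall a b, L a -> L b -> a != b -> ft mu (a - b) = 0) ->
  (forall f, L2fun mu f -> forall eps, 0 < eps ->
    exists2 r, (forall p, p \in r -> L p.2) &
      (E2 mu (fun x => f x - trigpoly r x)%R < eps%:E)%E) ->
  spectrum mu L.
Proof.
move=> cL oL dL; split=> //; split=> [i _|a b La Lb|f fL eps e0].
- exact: expo_L2fun.
- rewrite L2inner_expo; have [->|ab] := eqVneq a b; first by rewrite subrr ft0.
  exact: oL.
have [r rL rE] := dL f fL (eps ^+ 2) (exprn_gt0 _ e0).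
exists [fset p.2 | p in r]%fset, (fun l => \sum_(p <- r | p.2 == l) p.1); split.
  by move=> _ /imfsetP[p /rL pL ->].
by rewrite L2norm_ltP //; move: rE; rewrite trigpoly_collect.
Qed.

End Spectra.

(** * Zeros of a single geometric factor *)

Section MaskZeros.
Context {K : realType}.
Implicit Types (x y : K).

Lemma sum_ex_geom N x : \sum_(k < N) ex (k%:R * x) = \sum_(k < N) ex x ^+ k :> K[i].
Proof. by apply: eq_bigr => k _; rewrite mulr_natl exXn. Qed.

Lemma natc_neq0 n : (0 < n)%N -> n%:R != 0 :> K[i].
Proof. by move=> n0; rewrite pnatr_eq0 -lt0n. Qed.

Lemma natr_neq0 n : (0 < n)%N -> n%:R != 0 :> K.
Proof. by move=> n0; rewrite pnatr_eq0 -lt0n. Qed.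

Lemma unit_mask_int N (c : int) : (0 < N)%N -> unit_mask N c%:~R = 1 :> K[i].
Proof.
move=> N0; rewrite /unit_mask sum_ex_geom ex_int.
under eq_bigr do rewrite expr1n.
by rewrite sumr_const card_ord mulVf // natc_neq0.
Qed.

(** The sum is geometric with ratio [ex x]; it vanishes exactly when this ratio is an [N]-th root of
    unity other than 1. *)
Lemma unit_mask_eq0P N x : (0 < N)%N -> unit_mask N x = 0 <->
  exists2 b : int, ~~ (N %| b)%Z & N%:R * x = b%:~R.
Proof.
move=> N0; have Nr0 := natr_neq0 N0; have exN1 : ex x ^+ N = ex (N%:R * x).
  by rewrite -exXn mulr_natl.
split=> [x0|[b Nb xb]].
  have s0 : \sum_(k < N) ex x ^+ k = 0.
    move: x0 => /eqP; rewrite /unit_mask sum_ex_geom mulf_eq0 invr_eq0.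
    by rewrite (negbTE (natc_neq0 N0)) => /eqP.
  have : ex (N%:R * x) = 1.
    by apply/eqP; rewrite -subr_eq0 -exN1 subrX1 s0 mulr0.
  move=> /ex_eq1[b xb]; exists b => //; apply/negP => /dvdzP[c bc].
  have xc : x = c%:~R.
    by apply: (mulfI Nr0); rewrite xb bc intrM mulrC pmulrn.
  by move/eqP: x0; rewrite xc unit_mask_int // oner_eq0.
have : (ex x - 1) * \sum_(k < N) ex x ^+ k = 0.
  by rewrite -subrX1 exN1 xb ex_int subrr.
move/eqP; rewrite mulf_eq0 => /orP[|/eqP s0]; last first.
  by rewrite /unit_mask sum_ex_geom s0 mulr0.
rewrite subr_eq0 => /eqP /ex_eq1[c xc]; case/negP: Nb; apply/dvdzP; exists c.
by apply/eqP; rewrite -(eqr_int K) -xb xc intrM mulrC -pmulrn.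
Qed.

End MaskZeros.

(** * Zeros of the Fourier transform, and necessity of the condition on [t] *)

Section Zeros.
Context {K : realType}.
Variables (mu : probability (measurableTypeR K) K) (N R q pm : nat) (P : seq nat).
Hypotheses (N1 : (1 < N)%N) (R1 : (1 < R)%N).
Hypotheses (Pq : forall j, j \in P -> (j < q)%N) (pmP : pm \in P).
Hypothesis (Ppm : forall j, j \in P -> (j <= pm)%N).
Local Notation M := (R * N ^ q)%N.
Hypothesis ft_eq : forall y : K, ft mu y = mask_poly N P (y / M%:R) * ft mu (y / M%:R).
Implicit Types (x y : K) (n : nat).

Let N0 : (0 < N)%N. Proof. exact: ltnW. Qed.
Let R0 : (0 < R)%N. Proof. exact: ltnW. Qed.
Let M1 : (1 < M)%N.
Proof. by rewrite (leq_trans R1) // leq_pmulr // expn_gt0 N0. Qed.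
Let M0 : (0 < M)%N. Proof. exact: ltnW. Qed.

Definition iter_mask n y : K[i] := \prod_(k < n) mask_poly N P (y / (M ^ k.+1)%:R).

Lemma ft_iter_mask n y : ft mu y = iter_mask n y * ft mu (y / (M ^ n)%:R).
Proof.
elim: n => [|n IH]; first by rewrite /iter_mask big_ord0 mul1r expn0 divr1.
rewrite {}IH /iter_mask big_ord_recr /= -mulrA [in LHS]ft_eq.
by rewrite -(mulrA y) -invfM -natrM -expnSr.
Qed.

Lemma cvg_div_expn y : y / (M ^ n)%:R @[n --> \oo] --> (0 : K).
Proof.
have -> : (fun n => y / (M ^ n)%:R) = (fun n => y * (M%:R^-1) ^+ n).
  by apply/funext => n; rewrite natrX exprVn.
rewrite -[X in _ --> X](mulr0 y); apply: cvgMr; apply: cvg_expr.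
rewrite ger0_norm ?invr_ge0 // invf_lt1 ?ltr0n // ltr1n //.
Qed.

Lemma cvg_ft_div_expn y : nsq (ft mu (y / (M ^ n)%:R)) @[n --> \oo] --> (1 : K).
Proof.
rewrite -[X in _ --> X]nsq1 -(ft0 mu).
exact: (cvg_comp _ _ (cvg_div_expn y) (@continuous_nsq_ft K mu _)).
Qed.

(** Since [ft mu (y / M ^ n)] tends to 1, a zero at [y] must come from one of finitely many mask
    factors, and then from one geometric factor of that mask. *)
Lemma ft_eq0 y : ft mu y = 0 -> exists k j (b : int),
  [/\ (0 < k)%N, j \in P, ~~ (N %| b)%Z &
      y = (R ^ k * N ^ (q * k - j.+1))%:R * b%:~R].
Proof.
move=> y0.
have [n yn] : exists n, ft mu (y / (M ^ n)%:R) != 0.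
  apply/not_existsP => H; have := cvg_ft_div_expn y.
  rewrite (_ : (fun n => _) = (fun=> 0)); last first.
    by apply/funext => n; have /negP/negPn/eqP -> := H n; rewrite nsq0.
  move/(cvg_unique _ (cvg_cst 0)) => H'; have /eqP := H' (@Rhausdorff K).
  by rewrite eq_sym oner_eq0.
move: y0; rewrite (ft_iter_mask n) => /eqP; rewrite mulf_eq0 (negbTE yn) orbF.
move=> /prodf_eq0[k _]; rewrite prodf_seq_eq0 => /hasP[j jP /= /eqP].
move=> /(unit_mask_eq0P _ N0)[b Nb yb]; exists k.+1, j, b; split=> //.
have jq : (j.+1 <= q * k.+1)%N.
  by rewrite (leq_trans (Pq jP)) // leq_pmulr.
apply: (@mulfI _ (N ^ j.+1)%:R); first by rewrite natr_neq0 // expn_gt0 N0.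
apply: (@mulfI _ ((M ^ k.+1)%:R^-1)).
  by rewrite invr_neq0 // natr_neq0 // expn_gt0 M0.
rewrite -[X in _ * (X * _)]/((N ^ j.+1)%:R).
transitivity (b%:~R : K).
  by rewrite -yb [(N ^ j.+1)%N]expnS natrM; ring.
have -> : (M ^ k.+1 = N ^ j.+1 * (R ^ k.+1 * N ^ (q * k.+1 - j.+1)))%N.
  by rewrite mulnCA -expnD subnKC // expnMn -expnM.
by rewrite [X in _ * X]mulrA -natrM mulKf // natr_neq0 // !muln_gt0 !expn_gt0 N0 R0.
Qed.

Local Notation e := (q - pm.+1)%N.

(** Among the exponents [q * k - j.+1] the smallest is reached at [k = 1] and [j = pm], where it
    equals [e]. *)
Lemma ft_eq0_dvd y : ft mu y = 0 -> exists c : int, y = (R * N ^ e)%:R * c%:~R.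
Proof.
move=> /ft_eq0[[|k] [j [b [// _ jP _ ->]]]].
exists ((R ^ k * N ^ (q * k.+1 - j.+1 - e))%:Z * b).
rewrite intrM -pmulrn mulrA -natrM; congr (_%:R * _).
rewrite expnS -!mulnA; congr (_ * _)%N; rewrite mulnCA -expnD subnKC //.
have := Ppm jP; have := Pq jP; rewrite mulnS; lia.
Qed.

(** The factor of exponent [pm] in the first mask already vanishes there. *)
Lemma ft_zero (b : int) : ~~ (N %| b)%Z -> ft mu ((R * N ^ e)%:R * b%:~R) = 0.
Proof.
move=> Nb; rewrite ft_eq; apply/eqP; rewrite mulf_eq0; apply/orP; left.
rewrite prodf_seq_eq0; apply/hasP; exists pm => //=; apply/eqP.
apply/(unit_mask_eq0P _ N0); exists b => //.
have -> : q = (e + pm.+1)%N by rewrite subnK // Pq.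
rewrite addnK expnD expnS !natrM.
have := @natr_neq0 K _ R0; have := @natr_neq0 K _ N0.
have : (N ^ pm)%:R != 0 :> K by rewrite natr_neq0 // expn_gt0 N0.
have : (N ^ e)%:R != 0 :> K by rewrite natr_neq0 // expn_gt0 N0.
by move=> *; field; do !(apply/andP; split).
Qed.

Lemma spectrum_diff G a b : spectrum mu G -> G a -> G b ->
  exists c : int, a - b = (R * N ^ e)%:R * c%:~R.
Proof.
move=> sG Ga Gb; have [->|ab] := eqVneq a b; first by exists 0; rewrite subrr mulr0.
exact: ft_eq0_dvd (spectrum_orthogonal sG Ga Gb ab).
Qed.

(** By maximality some [b] in [G] is not orthogonal to the translate [a + R * N ^ e]. By [ft_zero],
    [N] then divides [1 - c], so no divisor [l > 1] of [N] divides [c]. *)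
Lemma spectrum_diff_ndvd G a l : spectrum mu G -> G a -> (1 < l)%N -> (l %| N)%N ->
  exists b (c : int), [/\ G b, b - a = (R * N ^ e)%:R * c%:~R & ~~ (l %| `|c|)%N].
Proof.
move=> sG Ga l1 lN.
have [b Gb ab] := spectrum_maximal (a + (R * N ^ e)%:R) sG.
have [c bac] := spectrum_diff sG Gb Ga; exists b, c; split=> //.
apply/negP => lc; case/negP: ab; apply/eqP.
have -> : a + (R * N ^ e)%:R - b = (R * N ^ e)%:R * (1 - c)%:~R.
  by rewrite rmorphB rmorph1 mulrBr -bac mulr1; ring.
apply: ft_zero; apply/negP => Nc.
have : (l %| 1 - c)%Z by apply: dvdz_trans Nc.
move=> l1c; have : (l %| (1 - c) + c)%Z by apply: rpredD.
by rewrite subrK dvdzE /= dvdn1 => /eqP l1'; rewrite l1' in l1.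
Qed.

Lemma spectra_ratio L t : spectrum mu L -> spectrum mu [set t * x | x in L] ->
  exists t1 t2 : int, [/\ t = t1%:~R / t2%:~R, coprimez t1 t2, coprimez t1 N & coprimez t2 N].
Proof.
move=> sL stL; have E0 : (R * N ^ e)%:R != 0 :> K.
  by rewrite natr_neq0 // muln_gt0 R0 expn_gt0 N0.
have [a La _] := spectrum_maximal 0 sL.
(* The choice [l = N] serves to produce a nonzero difference, from which [t] is seen to be
   rational. *)
have [b1 [c1 [Lb1 b1a c1N]]] := spectrum_diff_ndvd sL La N1 (dvdnn N).
have c10 : c1 != 0 by apply: contraNneq c1N => ->; rewrite dvdn0.
have tL x : L x -> [set t * x | x in L] (t * x) by exists x.
have ratio b c : L b -> b - a = (R * N ^ e)%:R * c%:~R ->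
    exists c', t * b - t * a = (R * N ^ e)%:R * c'%:~R /\ t * c%:~R = c'%:~R.
  move=> Lb bac; have [c' tbac] := spectrum_diff stL (tL b Lb) (tL a La).
  by exists c'; split=> //; apply: (mulfI E0); rewrite -tbac -mulrBr bac; ring.
have [c1' [_ tc1]] := ratio _ _ Lb1 b1a.
pose r : rat := c1'%:Q / c1%:Q.
have c1r0 : c1%:~R != 0 :> K by rewrite intr_eq0.
have tr : t = ratr r.
  by apply: (mulIf c1r0); rewrite tc1 /r fmorph_div /= !ratr_int divfK.
have t2r0 : (denq r)%:~R != 0 :> K by rewrite intr_eq0 denq_neq0.
have trE : t * (denq r)%:~R = (numq r)%:~R by rewrite tr /ratr divfK.
(* With [t] in lowest terms, a difference in [L] and its image in [t L] are tied by an identity of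
   natural numbers, in which prime factors can be traced. *)
have cross c c' : t * c%:~R = c'%:~R -> (`|numq r| * `|c| = `|c'| * `|denq r|)%N.
  move=> tc; rewrite -!abszM; congr (absz _); apply/eqP; rewrite -(eqr_int K).
  by rewrite !intrM -trE -tc; apply/eqP; ring.
have cop := coprime_num_den r.
have key (u : int) : (forall l, prime l -> (l %| N)%N -> (l %| `|u|)%N -> False) ->
    coprimez u N.
  move=> H; rewrite coprimezE /=; have [//|ncop] := boolP (coprime `|u| N).
  have g1 : (1 < gcdn `|u| N)%N.
    by rewrite ltn_neqAle eq_sym ncop gcdn_gt0 N0 orbT.
  case: (H _ (pdiv_prime g1)).
    by rewrite (dvdn_trans (pdiv_dvd _)) // dvdn_gcdr.
  by rewrite (dvdn_trans (pdiv_dvd _)) // dvdn_gcdl.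
have ndvd l : prime l -> ~ ((l %| `|numq r|)%N /\ (l %| `|denq r|)%N).
  move=> pl [ln ld]; have : (l %| gcdn `|numq r| `|denq r|)%N by rewrite dvdn_gcd ln.
  by rewrite (eqP cop) dvdn1 => /eqP l1; rewrite l1 in pl.
exists (numq r), (denq r); split=> //.
(* Here the difference not divisible by [l] is taken in [t L]: if [l] divides the numerator, it must
   divide the denominator too. The other case is symmetric, with the difference taken in [L]. *)
- apply: key => l pl lN ln.
  have [_ [c' [[b Lb <-] tbac c'l]]] :=
    spectrum_diff_ndvd stL (tL a La) (prime_gt1 pl) lN.
  have [c bac] := spectrum_diff sL Lb La.
  have [c'' [tbac' tc]] := ratio _ _ Lb bac.
  have c'c : c' = c''.
    by apply/eqP; rewrite -(eqr_int K); apply/eqP/(mulfI E0); rewrite -tbac.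
  have : (l %| `|c'| * `|denq r|)%N by rewrite c'c -(cross _ _ tc) dvdn_mulr.
  rewrite Euclid_dvdM // (negbTE c'l) /= => ld.
  exact: (ndvd l pl).
- apply: key => l pl lN ld.
  have [b [c [Lb bac cl]]] := spectrum_diff_ndvd sL La (prime_gt1 pl) lN.
  have [c' [_ tc]] := ratio _ _ Lb bac.
  have : (l %| `|numq r| * `|c|)%N by rewrite (cross _ _ tc) dvdn_mull.
  rewrite Euclid_dvdM // (negbTE cl) orbF => ln.
  exact: (ndvd l pl).
Qed.

End Zeros.

(** * The closed span of a family of characters in [L^2(mu)] *)

Section SpanDensity.
Context {K : realType}.
Variables (mu : probability (measurableTypeR K) K) (G : set K).
Implicit Types (f g : K -> K[i]) (h : K -> K) (r : seq (K[i] * K)) (x y : K).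

Notation mfun f := (measurable_fun (setT : set (measurableTypeR K))
  (f : measurableTypeR K -> measurableTypeR K)).

Definition cmeas f := mfun (fun x => complex.Re (f x)) /\ mfun (fun x => complex.Im (f x)).

(** Measurability is included because the estimates of [E2] on sums and multiples rely on it;
    boundedness is not, the target being all of [L^2(mu)]. *)
Definition in_closed_span f := cmeas f /\ forall eps, 0 < eps ->
  exists2 r, (forall p, p \in r -> G p.2) &
    (E2 mu (fun x => f x - trigpoly r x)%R < eps%:E)%E.

Definition re_in_closed_span h := in_closed_span (fun x => h x +i* 0).

Lemma bmeas_cmeas f : bmeas f -> cmeas f.
Proof. by case. Qed.

Lemma cmeasD f g : cmeas f -> cmeas g -> cmeas (fun x => f x + g x).
Proof.
move=> [f1 f2] [g1 g2]; split.
- by under eq_fun do rewrite Re_add; exact: measurable_funD.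
- by under eq_fun do rewrite Im_add; exact: measurable_funD.
Qed.

Lemma cmeasM f g : cmeas f -> cmeas g -> cmeas (fun x => f x * g x).
Proof.
move=> [f1 f2] [g1 g2]; split.
- by under eq_fun do rewrite Re_mul; apply: measurable_funB; exact: measurable_funM.
- by under eq_fun do rewrite Im_mul; apply: measurable_funD; exact: measurable_funM.
Qed.

Lemma cmeas_cst (c : K[i]) : cmeas (fun=> c).
Proof. exact: bmeas_cmeas (bmeas_cst c). Qed.

Lemma cmeasN f : cmeas f -> cmeas (fun x => - f x).
Proof.
by move=> mf; under eq_fun do rewrite -mulN1r; exact: cmeasM (cmeas_cst _) mf.
Qed.

Lemma cmeasB f g : cmeas f -> cmeas g -> cmeas (fun x => f x - g x).
Proof. by move=> mf mg; exact: cmeasD mf (cmeasN mg). Qed.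

Lemma measurable_nsq f : cmeas f -> measurable_fun (setT : set (measurableTypeR K))
  (fun x => (nsq (f x))%:E).
Proof.
move=> [f1 f2]; apply/measurable_EFinP; apply: measurable_funD; exact: measurable_funX.
Qed.

(** Stands in for the triangle inequality; its constant 2 is the reason for the [eps / 4] in the
    closure lemmas. *)
Lemma E2D_le f g : cmeas f -> cmeas g ->
  (E2 mu (fun x => f x + g x)%R <= 2%:E * E2 mu f + 2%:E * E2 mu g)%E.
Proof.
move=> mf mg; have nf := measurable_nsq mf; have ng := measurable_nsq mg.
have nsq0 (u : K -> K[i]) x : (0 <= (nsq (u x))%:E)%E by rewrite lee_fin nsq_ge0.
rewrite /E2 -!ge0_integralZl // -ge0_integralD //; last 4 first.
- by move=> x _; rewrite mule_ge0.
- exact: measurable_funeM.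
- by move=> x _; rewrite mule_ge0.
- exact: measurable_funeM.
apply: ge0_le_integral => //.
- by move=> x _; exact: (nsq0 (fun x => f x + g x)).
- exact: measurable_nsq (cmeasD mf mg).
- by apply: emeasurable_funD; exact: measurable_funeM.
- by move=> x _; rewrite -!EFinM -EFinD lee_fin nsqD_le.
Qed.

Lemma E2Z (c : K[i]) f : cmeas f ->
  E2 mu (fun x => c * f x)%R = ((nsq c)%:E * E2 mu f)%E.
Proof.
move=> mf; rewrite /E2 -ge0_integralZl //.
- by apply: eq_integral => x _; rewrite nsqM EFinM.
- exact: measurable_nsq.
- by move=> x _; rewrite lee_fin nsq_ge0.
- by rewrite lee_fin nsq_ge0.
Qed.

Lemma cmeas_trigpoly r : cmeas (trigpoly r).
Proof. exact: bmeas_cmeas (bmeas_trigpoly r). Qed.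

Lemma trigpoly_cat r1 r2 x : trigpoly (r1 ++ r2) x = trigpoly r1 x + trigpoly r2 x.
Proof. by rewrite /trigpoly big_cat. Qed.

Lemma trigpoly_scale (c : K[i]) r x :
  trigpoly [seq (c * p.1, p.2) | p <- r] x = c * trigpoly r x.
Proof.
by rewrite /trigpoly big_map mulr_sumr; apply: eq_bigr => p _; rewrite mulrA.
Qed.

Lemma closed_spanD f g : in_closed_span f -> in_closed_span g ->
  in_closed_span (fun x => f x + g x).
Proof.
move=> [mf Vf] [mg Vg]; split; first exact: cmeasD.
move=> eps e0; have e4 : 0 < eps / 4 by rewrite divr_gt0.
have [r1 r1G r1E] := Vf _ e4; have [r2 r2G r2E] := Vg _ e4.
exists (r1 ++ r2) => [p|]; first by rewrite mem_cat => /orP[/r1G|/r2G].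
rewrite (_ : (fun x => _) = (fun x => (f x - trigpoly r1 x) + (g x - trigpoly r2 x))%R); last first.
  by apply/funext => x; rewrite trigpoly_cat; ring.
have m1 := cmeas_trigpoly r1; have m2 := cmeas_trigpoly r2.
apply: (le_lt_trans (E2D_le (cmeasB mf m1) (cmeasB mg m2))).
move: r1E r2E; move: (E2 mu _) (E2_ge0 mu (fun x => f x - trigpoly r1 x)) => a a0 ae.
move: (E2 mu _) (E2_ge0 mu (fun x => g x - trigpoly r2 x)) => b b0 be.
move: a b a0 b0 ae be => [a||] [b||] // _ _; rewrite ?lte_fin => ae be.
lra.
Qed.

Lemma closed_spanZ (c : K[i]) f : in_closed_span f -> in_closed_span (fun x => c * f x).
Proof.
move=> [mf Vf]; split; first exact: cmeasM (cmeas_cst c) mf.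
move=> eps e0; have c0 := nsq_ge0 c.
have e4 : 0 < eps / (nsq c + 1) by rewrite divr_gt0 // ltr_wpDl.
have [r rG rE] := Vf _ e4; exists [seq (c * p.1, p.2) | p <- r].
  by move=> _ /mapP[p pr ->] /=; exact: rG.
rewrite (_ : (fun x => _) = (fun x => c * (f x - trigpoly r x))%R); last first.
  by apply/funext => x; rewrite trigpoly_scale; ring.
rewrite E2Z; last exact: cmeasB mf (cmeas_trigpoly r).
move: rE; move: (E2 mu _) (E2_ge0 mu (fun x => f x - trigpoly r x)) => a.
move: a => [a||] //; rewrite ?lte_fin ?lee_fin => a0 ae.
apply: (@le_lt_trans _ _ ((nsq c + 1) * a)); first by rewrite ler_wpM2r // lerDl.
by rewrite -ltr_pdivlMl ?ltr_wpDl // mulrC.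
Qed.

Lemma closed_span_lim (F : nat -> K -> K[i]) f : (forall n, in_closed_span (F n)) ->
  cmeas f ->
  (forall eps, 0 < eps -> exists n, (E2 mu (fun x => f x - F n x)%R < eps%:E)%E) ->
  in_closed_span f.
Proof.
move=> VF mf Ff; split=> // eps e0; have e4 : 0 < eps / 4 by rewrite divr_gt0.
have [n nE] := Ff _ e4; have [mFn /(_ _ e4)[r rG rE]] := VF n; exists r => //.
rewrite (_ : (fun x => _) = (fun x => (f x - F n x) + (F n x - trigpoly r x))%R); last first.
  by apply/funext => x; ring.
apply: (le_lt_trans (E2D_le (cmeasB mf mFn) (cmeasB mFn (cmeas_trigpoly r)))).
move: nE rE; move: (E2 mu _) (E2_ge0 mu (fun x => f x - F n x)) => a a0 ae.
move: (E2 mu _) (E2_ge0 mu (fun x => F n x - trigpoly r x)) => b b0 be.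
move: a b a0 b0 ae be => [a||] [b||] // _ _; rewrite ?lte_fin => ae be.
lra.
Qed.

Lemma re_closed_spanD h1 h2 : re_in_closed_span h1 -> re_in_closed_span h2 ->
  re_in_closed_span (fun x => h1 x + h2 x).
Proof.
move=> V1 V2; rewrite /re_in_closed_span.
rewrite (_ : (fun x => _) = (fun x => (h1 x +i* 0) + (h2 x +i* 0))); first exact: closed_spanD.
by apply/funext => x; apply: eqcP; rewrite //= addr0.
Qed.

Lemma re_closed_spanZ (c : K) h : re_in_closed_span h -> re_in_closed_span (fun x => c * h x).
Proof.
move=> V1; rewrite /re_in_closed_span.
rewrite (_ : (fun x => _) = (fun x => (c +i* 0) * (h x +i* 0))); first exact: closed_spanZ.
by apply/funext => x; apply: eqcP; rewrite ?Re_mul ?Im_mul //=; ring.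
Qed.

(** Dominated convergence, applied to the squares [(h x - F n x) ^ 2], turns the pointwise limit
    into a limit in [L^2(mu)]. *)
Lemma re_closed_span_dominated (F : nat -> K -> K) h (g : K -> K) :
  (forall n, re_in_closed_span (F n)) -> mfun h ->
  (forall x, F n x @[n --> \oo] --> h x) ->
  (forall n x, (h x - F n x) ^+ 2 <= g x) -> mu.-integrable setT (EFin \o g) ->
  re_in_closed_span h.
Proof.
move=> VF mh Fh Fg ig; apply: (closed_span_lim VF).
  by split=> //; exact: measurable_cst.
have mF n : mfun (F n) by have [[]] := VF n.
have [|||||_ _ cvg] := @dominated_convergence _ _ _ mu setT measurableT
    (fun n x => ((h x - F n x) ^+ 2)%:E) (fun x => 0%E) (EFin \o g).
- by move=> n; apply/measurable_EFinP; exact: (measurable_funX 2 (measurable_funB mh (mF n))).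
- exact: measurable_cst.
- apply: aeW => x _; apply: cvg_EFin; first exact: nearW.
  rewrite [X in _ --> X](_ : 0 = (h x - h x) ^+ 2); last by rewrite subrr expr0n.
  have cB : h x - F n x @[n --> \oo] --> h x - h x by apply: cvgB => //; exact: cvg_cst.
  exact: (cvgM cB cB).
- exact: ig.
- by apply: aeW => x n _ /=; rewrite ger0_norm ?sqr_ge0 // lee_fin.
move=> eps e0; rewrite integral0 in cvg.
have /cvg : nbhs 0%E [set u : \bar K | (u < eps%:E)%E].
  by apply: open_ereal_lt'; rewrite lte_fin.
move=> [n _ /(_ n (leqnn n)) nE]; exists n; apply: le_lt_trans nE.
rewrite /E2 le_eqVlt; apply/orP; left; apply/eqP; apply: eq_integral => x _.
by rewrite /nsq /= subrr expr0n addr0.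
Qed.

Lemma re_closed_span_bounded (F : nat -> K -> K) h (C : K) :
  (forall n, re_in_closed_span (F n)) -> mfun h ->
  (forall x, F n x @[n --> \oo] --> h x) ->
  (forall n x, `|F n x| <= C) -> re_in_closed_span h.
Proof.
move=> VF mh Fh FC; have hC x : `|h x| <= C.
  have cvg : `|F n x| @[n --> \oo] --> `|h x| by apply: cvg_norm; exact: Fh.
  rewrite -(cvg_lim (@Rhausdorff K) cvg); apply: limr_le; first exact: cvgP cvg.
  exact: nearW.
apply: (re_closed_span_dominated VF mh Fh (g := fun=> (2 * C) ^+ 2)).
  move=> n x; have := hC x; have := FC n x.
  rewrite !ler_norml => /andP[F1 F2] /andP[h1 h2].
  have a0 : 0 <= 2 * C - (h x - F n x) by lra.
  have b0 : 0 <= 2 * C + (h x - F n x) by lra.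
  by have := mulr_ge0 a0 b0; lra.
by apply: (@integrable_bounded _ _ _ ((2 * C) ^+ 2)) => [|x];
  [exact: measurable_cst|rewrite ger0_norm ?sqr_ge0].
Qed.

(** * Density: from characters to sign functions, rays, Borel sets and square-integrable
    functions *)

Hypothesis closed_span_ex : forall y, in_closed_span (fun x => ex (y * x)).

Lemma closed_span_trigpoly r : in_closed_span (trigpoly r).
Proof.
elim: r => [|[c y] r IH].
  rewrite (_ : trigpoly [::] = (fun x => 0 * ex (0 * x))).
    exact: closed_spanZ (closed_span_ex 0).
  by apply/funext => x; rewrite /trigpoly big_nil mul0r.
rewrite (_ : trigpoly _ = (fun x => c * ex (y * x) + trigpoly r x)).
  exact: closed_spanD (closed_spanZ _ (closed_span_ex y)) IH.
by apply/funext => x; rewrite /trigpoly big_cons.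
Qed.

Definition is_trigpoly h := exists r, trigpoly r = (fun x => h x +i* 0).

Lemma is_trigpoly_span h : is_trigpoly h -> re_in_closed_span h.
Proof. by move=> [r rh]; rewrite /re_in_closed_span -rh; exact: closed_span_trigpoly. Qed.

Lemma is_trigpolyD h1 h2 : is_trigpoly h1 -> is_trigpoly h2 ->
  is_trigpoly (fun x => h1 x + h2 x).
Proof.
move=> [r1 e1] [r2 e2]; exists (r1 ++ r2); apply/funext => x.
by rewrite trigpoly_cat e1 e2; apply: eqcP; rewrite //= addr0.
Qed.

Lemma trigpolyM r1 r2 x :
  trigpoly [seq (p.1 * s.1, p.2 + s.2) | p <- r1, s <- r2] x = trigpoly r1 x * trigpoly r2 x.
Proof.
rewrite /trigpoly big_allpairs_dep mulr_suml; apply: eq_bigr => p _.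
by rewrite mulr_sumr; apply: eq_bigr => s _ /=; rewrite mulrDl exD; ring.
Qed.

Lemma is_trigpolyM h1 h2 : is_trigpoly h1 -> is_trigpoly h2 ->
  is_trigpoly (fun x => h1 x * h2 x).
Proof.
move=> [r1 e1] [r2 e2]; exists [seq (p.1 * s.1, p.2 + s.2) | p <- r1, s <- r2].
apply/funext => x; rewrite trigpolyM e1 e2.
by apply: eqcP; rewrite ?Re_mul ?Im_mul //=; ring.
Qed.

Lemma is_trigpoly_cst (c : K) : is_trigpoly (fun=> c).
Proof.
exists [:: (c +i* 0, 0)]; apply/funext => x.
by rewrite /trigpoly big_seq1 mul0r ex0 mulr1.
Qed.

Lemma is_trigpoly_sin (a b : K) : is_trigpoly (fun x => sin (2 * pi * (a * x + b))).
Proof.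
(* Euler's formula for the sine: the coefficients are [1 / (2i)] and its opposite, with the phase
   [b] absorbed into them. *)
exists [:: ((0 +i* - 2^-1) * ex b, a); ((0 +i* 2^-1) * ex (- b), - a)].
apply/funext => x; rewrite /trigpoly big_cons big_seq1 /= -!mulrA -!exD.
rewrite mulNr -opprD exN (addrC b); set y := a * x + b.
by apply: eqcP; rewrite ?Re_add ?Im_add ?Re_mul ?Im_mul /= ?mulrA; field.
Qed.

(* Iterating the odd polynomial (3u - u^3)/2 on [-1, 1] converges to the sign. *)
Definition sharpen (u : K) : K := (3 * u - u ^+ 3) / 2.

Lemma is_trigpoly_sharpen n h : is_trigpoly h -> is_trigpoly (fun x => iter n sharpen (h x)).
Proof.
move=> Th; elim: n => // n IH.
rewrite (_ : (fun x => _) = (fun x => 2^-1 * (3 * iter n sharpen (h x) +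
    - 1 * (iter n sharpen (h x) * (iter n sharpen (h x) * iter n sharpen (h x)))))).
  apply: is_trigpolyM; first exact: is_trigpoly_cst.
  apply: is_trigpolyD; apply: is_trigpolyM; do ?exact: is_trigpoly_cst => //.
    exact: IH.
  by do 2!(apply: is_trigpolyM; first exact: IH).
by apply/funext => x; rewrite iterS /sharpen; field.
Qed.

(** One step multiplies the gap [1 - v] by [(1 - v) (2 + v) / 2], which is at most [1 - v / 2],
    hence at most [1 - u / 2] because the iterates never fall below [u]. *)
Lemma iter_sharpen_bounds n (u : K) : 0 <= u <= 1 ->
  u <= iter n sharpen u <= 1 /\ 1 - iter n sharpen u <= (1 - u / 2) ^+ n.
Proof.
move=> /andP[u0 u1]; elim: n => [|n [/andP[v0 v1] IH]].
  by rewrite /= lexx u1 expr0; split=> //; lra.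
rewrite iterS; set v := iter n sharpen u in v0 v1 IH *.
have E1 : sharpen v - v = v * (1 - v) * (1 + v) / 2 by rewrite /sharpen; field.
have E2 : 1 - sharpen v = (1 - v) * ((1 - v) * (2 + v) / 2) by rewrite /sharpen; field.
have vge0 : 0 <= v by lra.
have p1 : 0 <= v * (1 - v) * (1 + v) / 2.
  by rewrite !mulr_ge0 ?invr_ge0 // ?subr_ge0 // addr_ge0.
have p2 : 0 <= (1 - v) * ((1 - v) * (2 + v) / 2).
  by rewrite !mulr_ge0 ?invr_ge0 ?subr_ge0 // addr_ge0.
split; first by apply/andP; split; lra.
rewrite E2 exprSr ler_pM ?subr_ge0 //.
  by rewrite !mulr_ge0 ?invr_ge0 ?subr_ge0 // addr_ge0.
have := mulr_ge0 vge0 vge0; nra.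
Qed.

Lemma cvg_iter_sharpen (u : K) : `|u| <= 1 -> iter n sharpen u @[n --> \oo] --> Num.sg u.
Proof.
have pos v : 0 < v <= 1 -> iter n sharpen v @[n --> \oo] --> (1 : K).
  move=> /andP[v0 v1]; have vv : 0 <= v <= 1 by rewrite ltW.
  apply: (@squeeze_cvgr _ _ _ _ (fun n => 1 - (1 - v / 2) ^+ n) (fun=> 1)).
  - by apply: nearW => n; have [/andP[_ ->]] := iter_sharpen_bounds n vv; lra.
  - rewrite -[X in _ --> X]subr0; apply: cvgB; first exact: cvg_cst.
    by apply: cvg_expr; rewrite ger0_norm; lra.
  - exact: cvg_cst.
have odd n v : iter n sharpen (- v) = - iter n sharpen v.
  by elim: n => // n IH; rewrite !iterS IH /sharpen; field.
rewrite ler_norml => /andP[u1 u2]; case: sgrP => [->|u0|u0].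
- rewrite (_ : (fun n => _) = (fun=> 0)); first exact: cvg_cst.
  apply/funext; elim=> // n IH; by rewrite iterS IH /sharpen expr0n mulr0 subrr mul0r.
- by apply: pos; rewrite u0.
rewrite -[u]opprK; under eq_fun do rewrite odd.
by apply: cvgN; apply: pos; lra.
Qed.

Lemma iter_sharpen_norm n (u : K) : `|u| <= 1 -> `|iter n sharpen u| <= 1.
Proof.
rewrite !ler_norml => /andP[u1 u2].
have odd v : iter n sharpen (- v) = - iter n sharpen v.
  by elim: n => // n IH; rewrite !iterS IH /sharpen; field.
have [u0|u0] := leP 0 u.
  by have [|/andP[a b] _] := @iter_sharpen_bounds n u; lra.
have [|/andP[]] := @iter_sharpen_bounds n (- u); first by lra.
by rewrite odd; lra.
Qed.

Lemma measurable_sg h : mfun h -> mfun (fun x => Num.sg (h x)).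
Proof.
move=> mh; have -> : (fun x => Num.sg (h x)) =
    (fun x => \1_(h @^-1` `]0, +oo[) x - \1_(h @^-1` `]-oo, 0[) x).
  apply/funext => x; rewrite !indicE.
  have -> : (x \in h @^-1` `]0, +oo[) = (0 < h x).
    by apply/idP/idP; rewrite inE /= in_itv /= andbT.
  have -> : (x \in h @^-1` `]-oo, 0[) = (h x < 0).
    by apply/idP/idP; rewrite inE /= in_itv.
  by case: sgrP => //; rewrite ?subrr ?subr0 ?sub0r.
apply: measurable_funB; apply: measurable_indic;
  by rewrite -[X in measurable X]setTI; apply: mh => //; exact: measurable_itv.
Qed.

(** Sharpening the sine keeps it a trigonometric polynomial bounded by 1 and converges pointwise to
    the square wave. *)
Lemma closed_span_sg_sin (a b : K) :
  re_in_closed_span (fun x => Num.sg (sin (2 * pi * (a * x + b)))).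
Proof.
have T := is_trigpoly_sin a b; have [[mT _] _] := is_trigpoly_span T.
apply: (re_closed_span_bounded (C := 1)
    (F := fun n x => iter n sharpen (sin (2 * pi * (a * x + b))))).
- by move=> n; apply: is_trigpoly_span; exact: is_trigpoly_sharpen.
- exact: measurable_sg.
- by move=> x; apply: cvg_iter_sharpen; rewrite ler_norml sin_geN1 sin_le1.
- by move=> n x; apply: iter_sharpen_norm; rewrite ler_norml sin_geN1 sin_le1.
Qed.

Lemma sg_sin (y : K) : `|y| < 2^-1 -> Num.sg (sin (2 * pi * y)) = Num.sg y.
Proof.
have pos (v : K) : 0 < v < 2^-1 -> 0 < sin (2 * pi * v).
  move=> /andP[v0 v1]; have p0 := pi_gt0 K.
  have -> : 2 * pi * v = pi * (2 * v) by ring.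
  apply: sin_gt0_pi; rewrite !mulr_gt0 //= gtr_pMr //; lra.
rewrite ltr_norml => /andP[y1 y2]; have [y0|y0|<-] := ltgtP 0 y.
- by rewrite !gtr0_sg // pos // y0.
- rewrite (ltr0_sg y0) ltr0_sg // -oppr_gt0 -sinN -mulrN pos //; lra.
- by rewrite mulr0 sin0.
Qed.

(* The square waves sg (sin (2 pi (x - a) / P)) tend to sg (x - a) as P grows. *)
Lemma closed_span_sg (a : K) : re_in_closed_span (fun x => Num.sg (x - a)).
Proof.
apply: (re_closed_span_bounded (C := 1) (F := fun n x =>
  Num.sg (sin (2 * pi * (n.+1%:R^-1 * x + - (n.+1%:R^-1 * a)))))).
- by move=> n; exact: closed_span_sg_sin.
- by apply: measurable_sg; apply: measurable_funB; [exact: measurable_id|exact: measurable_cst].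
- move=> x; apply: cvg_near_cst; have e0 : 0 < (2 * (`|x - a| + 1))^-1.
    by rewrite invr_gt0 mulr_gt0 // ltr_wpDl.
  near=> n; have nS : 0 < n.+1%:R^-1 :> K by rewrite invr_gt0.
  rewrite -mulrBr sg_sin; first by rewrite sgrM (gtr0_sg nS) mul1r.
  rewrite normrM gtr0_norm //.
  have n1 : n.+1%:R^-1 < (2 * (`|x - a| + 1))^-1.
    by near: n; exact: (near_infty_natSinv_lt (PosNum e0)).
  have xa : 0 <= `|x - a| by [].
  apply: (@le_lt_trans _ _ ((2 * (`|x - a| + 1))^-1 * `|x - a|)).
    by rewrite ler_wpM2r // ltW.
  rewrite invfM -mulrA -[ltRHS]mulr1 ltr_pM2l ?invr_gt0 // mulrC ltr_pdivrMr ?ltr_wpDl //.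
  by rewrite mul1r ltrDl.
by move=> n x; case: sgrP => _; rewrite ?normr0 ?normr1 ?normrN1.
Unshelve. all: by end_near.
Qed.

Lemma closed_span_ray (a : K) : re_in_closed_span (fun x => \1_(`]a, +oo[) x).
Proof.
(* The jump is placed at [a + n.+1^-1], to the right of [a], so that the limit is 0 at [a] itself
   and the ray comes out open. *)
apply: (re_closed_span_bounded (C := 1) (F := fun n x =>
  2^-1 * (1 + Num.sg (x - (a + n.+1%:R^-1))))).
- move=> n; apply: re_closed_spanZ; apply: re_closed_spanD (closed_span_sg _).
  exact: is_trigpoly_span (is_trigpoly_cst 1).
- by apply: measurable_indic; exact: measurable_itv.
- move=> x; rewrite indicE.
  have -> : (x \in `]a, +oo[%classic) = (a < x) by apply/idP/idP; rewrite inE /= in_itv /= andbT.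
  have [ax|xa] := ltP a x.
    have e0 : 0 < x - a by rewrite subr_gt0.
    apply: cvg_near_cst; near=> n.
    have n1 : n.+1%:R^-1 < x - a by near: n; exact: (near_infty_natSinv_lt (PosNum e0)).
    move: n1; move: (n.+1%:R^-1) => u n1; rewrite gtr0_sg; last by lra.
    by rewrite -[1 + 1]/2 mulVf.
  apply: cvg_near_cst; near=> n; have nS : 0 < n.+1%:R^-1 :> K by rewrite invr_gt0.
  move: nS; move: (n.+1%:R^-1) => u nS; rewrite ltr0_sg; last by lra.
  by rewrite subrr mulr0.
move=> n x; rewrite normrM ger0_norm ?invr_ge0 //.
by case: sgrP => _; rewrite ?addr0 ?subrr ?normr0 ?normr1 ?mulr0 ?mulr1 // ?ger0_norm //; lra.
Unshelve. all: by end_near.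
Qed.

(** Dynkin's theorem: open rays are stable under intersection and generate the Borel sets, while the
    sets with indicator in the closed span are stable under complements and countable disjoint
    unions. *)
Lemma closed_span_indic (A : set (measurableTypeR K)) : measurable A ->
  re_in_closed_span (fun x => \1_A x).
Proof.
have cst1 : re_in_closed_span (fun=> 1) := is_trigpoly_span (is_trigpoly_cst 1).
suff H : forall S, <<s @RGenOInfty.G K >> S -> re_in_closed_span (fun x => \1_S x).
  by move=> mA; apply: H; move: mA; rewrite RGenOInfty.measurableE.
apply: (@dynkin_induction _ (measurableTypeR K) (@RGenOInfty.G K)
  (fun S => re_in_closed_span (fun x => \1_S x))).
- exact: RGenOInfty.measurableE.
- move=> _ _ [x ->] [y ->]; exists (Num.max x y).
  by apply/seteqP; split=> z /=; rewrite !in_itv /= !andbT gt_max => /andP.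
- by under eq_fun do rewrite indicT.
- by move=> _ [x ->]; exact: closed_span_ray.
- move=> S mS VS; rewrite (_ : (fun x => _) = (fun x => 1 + -1 * \1_S x)).
    by apply: re_closed_spanD => //; exact: re_closed_spanZ.
  apply/funext => x; rewrite !indicE in_setC.
  by case: (x \in S); rewrite /= ?mulr1 ?subrr ?mulr0 ?addr0.
- move=> F mF tF VF.
  (* Disjointness makes the partial sums indicators, hence bounded by 1. *)
  have sumE n x : \sum_(k < n) \1_(F k) x = \1_(\big[setU/set0]_(k < n) F k) x :> K.
    elim: n => [|n IH]; first by rewrite !big_ord0 indic0.
    rewrite !big_ord_recr /= IH !indicE in_setU.
    have [xF|_] := boolP (x \in F n); last by rewrite orbF addr0.
    have [|_] := boolP (x \in _); last by rewrite add0r.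
    rewrite inE -bigcup_mkord => -[k /= kn Fk]; move: xF; rewrite inE => Fn.
    by move: kn; rewrite (tF k n I I _) ?ltnn //; exists x.
  apply: (re_closed_span_bounded (C := 1) (F := fun n x => \sum_(k < n) \1_(F k) x)).
  + move=> n; elim: n => [|n IH].
      under eq_fun do rewrite big_ord0.
      exact: is_trigpoly_span (is_trigpoly_cst 0).
    by under eq_fun do rewrite big_ord_recr; exact: re_closed_spanD.
  + by apply: measurable_indic; exact: bigcupT_measurable.
  + move=> x; apply: cvg_near_cst.
    have [[k _ Fk]|nF] := pselect ((\bigcup_k F k) x).
      near=> n; rewrite sumE !indicE !mem_set //; first by exists k.
      by rewrite -bigcup_mkord; exists k => //=; near: n; exact: nbhs_infty_gt.
    near=> n; rewrite sumE !indicE !memNset // -bigcup_mkord => -[k _ Fk].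
    by apply: nF; exists k.
  + by move=> n x; rewrite sumE indicE; case: (_ \in _); rewrite ?normr0 ?normr1.
Unshelve. all: by end_near.
Qed.

Import HBNNSimple.

Lemma closed_span_nnsfun (f : {nnsfun measurableTypeR K >-> K}) :
  re_in_closed_span f.
Proof.
have -> : (f : K -> K) = fun x => \sum_(i < #|` fset_set (f @` setT)|)
    (fset_set (f @` setT))`_i * \1_(f @^-1` [set (fset_set (f @` setT))`_i]) x.
  by apply/funext => x; rewrite (fimfunEord f).
move: #|` _| => n; elim: n => [|n IH].
  under eq_fun do rewrite big_ord0.
  exact: is_trigpoly_span (is_trigpoly_cst 0).
under eq_fun do rewrite big_ord_recr /=.
apply: re_closed_spanD => //; apply: re_closed_spanZ; exact: closed_span_indic.
Qed.

(** Increasing simple approximations [F n] satisfy [(h - F n) ^ 2 <= h ^ 2], and [h ^ 2] is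
    integrable. *)
Lemma closed_span_ge0 h : mfun h -> (forall x, 0 <= h x) ->
  mu.-integrable setT (fun x => (h x ^+ 2)%:E) -> re_in_closed_span h.
Proof.
move=> mh h0 ih.
have mhE : measurable_fun (setT : set (measurableTypeR K)) (EFin \o h).
  exact/measurable_EFinP.
have cF x : nnsfun_approx measurableT mhE n x @[n --> \oo] --> h x.
  apply: (@fine_cvg _ _ _ _ (fun n => (nnsfun_approx measurableT mhE n x)%:E) (h x)).
  by apply: cvg_nnsfun_approx => // z _; rewrite lee_fin.
apply: (re_closed_span_dominated (F := fun n => nnsfun_approx measurableT mhE n)
   (g := fun x => h x ^+ 2)) => // [n|n x]; first exact: closed_span_nnsfun.
have F0 : 0 <= nnsfun_approx measurableT mhE n x by [].
have Fh : nnsfun_approx measurableT mhE n x <= h x.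
  rewrite -(cvg_lim (@Rhausdorff K) (cF x)).
  apply: (nondecreasing_cvgn_le (u_ := fun n => nnsfun_approx measurableT mhE n x)).
    by move=> i j ij; have /lefP := nd_nnsfun_approx measurableT mhE ij; apply.
  exact: cvgP (cF x).
by rewrite lerXn2r ?nnegrE ?subr_ge0 // lerBlDr lerDl.
Qed.

(** Splits [f] into the positive and negative parts of its real and imaginary parts, each dominated
    by the modulus of [f]. *)
Lemma closed_span_square_integrable f : cmeas f -> (E2 mu f < +oo)%E ->
  in_closed_span f.
Proof.
move=> mf f2; have ifn : mu.-integrable setT (fun x => (nsq (f x))%:E).
  apply/integrableP; split; first exact: measurable_nsq.
  apply: le_lt_trans f2; rewrite le_eqVlt; apply/orP; left; apply/eqP.
  by apply: eq_integral => x _; rewrite gee0_abs // lee_fin nsq_ge0.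
have part h : mfun h -> (forall x, h x ^+ 2 <= nsq (f x)) -> re_in_closed_span h.
  have nonneg k : mfun k -> (forall x, 0 <= k x) -> (forall x, k x ^+ 2 <= nsq (f x)) ->
      re_in_closed_span k.
    move=> mk k0 kf; apply: closed_span_ge0 => //.
    apply: le_integrable ifn => //.
      by apply/measurable_EFinP; exact: measurable_funX.
    by move=> x _; rewrite /= lee_fin !ger0_norm ?sqr_ge0 ?nsq_ge0.
  move=> mh hf; rewrite (_ : h = fun x => Num.max (h x) 0 + -1 * Num.max (- h x) 0).
    apply: re_closed_spanD; last apply: re_closed_spanZ; apply: nonneg.
    - by apply: measurable_maxr => //; exact: measurable_cst.
    - by move=> x; rewrite le_max lexx orbT.
    - move=> x; have [_|_] := leP (h x) 0 => //; by rewrite expr0n nsq_ge0.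
    - by apply: measurable_maxr; [exact: measurable_funN|exact: measurable_cst].
    - by move=> x; rewrite le_max lexx orbT.
    - move=> x; have [_|_] := leP (- h x) 0; first by rewrite expr0n nsq_ge0.
      by rewrite sqrrN.
  apply/funext => x; have [h0|h0] := leP (h x) 0; have [h1|h1] := leP (- h x) 0; lra.
have [mf1 mf2] := mf.
rewrite (_ : f = fun x => (complex.Re (f x) +i* 0) + (0 +i* 1) * (complex.Im (f x) +i* 0)).
  apply: closed_spanD; last apply: closed_spanZ; apply: part => // x.
    by rewrite /nsq lerDl sqr_ge0.
  by rewrite /nsq lerDr sqr_ge0.
by apply/funext => x; apply: eqcP; rewrite ?Re_add ?Im_add ?Re_mul ?Im_mul /=; ring.
Qed.

End SpanDensity.

(** * From the Parseval identity on characters to a spectrum *)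

Section Parseval.
Context {K : realType}.
Variable mu : probability (measurableTypeR K) K.

(** By [E2_residual], the defect in Parseval's identity at [x] is the squared distance from the
    character of frequency [x] to a finite span, so every character lies in the closed span. *)
Lemma spectrum_of_parseval (L : set K) : countable L ->
  (forall a b, L a -> L b -> a != b -> ft mu (a - b) = 0) ->
  (forall x eps, 0 < eps -> exists s : seq K, [/\ uniq s, forall l, l \in s -> L l &
    1 - eps < \sum_(l <- s) nsq (ft mu (x - l))]) ->
  spectrum mu L.
Proof.
move=> cL oL pL.
have closed_span_ex y : in_closed_span mu L (fun x => ex (y * x)).
  split=> [|eps e0]; first exact: bmeas_cmeas (bmeas_ex y).
  have [s [us sL sE]] := pL y eps e0.
  exists [seq (ft mu (y - l), l) | l <- s]; first by move=> _ /mapP[l ls ->]; exact: sL.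
  rewrite (_ : (fun x => _) = trigpoly (residual mu y s)); last first.
    apply/funext => x; rewrite /trigpoly /residual big_cons !big_map mul1r.
    by rewrite -sumrN; congr (_ + _); apply: eq_bigr => l _; rewrite mulNr.
  rewrite E2_residual // => [|a b ai bi]; last by apply: oL; exact: sL.
  by rewrite lte_fin; lra.
apply: spectrum_intro => // f [f1 f2 f3] eps e0.
have [|_ /(_ _ e0)] := closed_span_square_integrable closed_span_ex (conj f1 f2).
  by rewrite -L2norm_ltyP.
by move=> [r rL rE]; exists r.
Qed.

End Parseval.

(** * Squared masks summed over dual digits *)

Section MaskSums.
Context {K : realType}.
Implicit Types (x u v : K) (t : int).

Lemma cR_sum (I : Type) (r : seq I) (F : I -> K) :
  (\sum_(i <- r) F i) +i* 0 = \sum_(i <- r) (F i +i* 0) :> K[i].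
Proof.
elim: r => [|i r IH]; first by rewrite !big_nil.
by rewrite !big_cons -IH; apply: eqcP; rewrite ?Re_add ?Im_add //= addr0.
Qed.

Lemma unit_mask_period N x (c : int) : unit_mask N (x + c%:~R) = unit_mask N x.
Proof.
rewrite /unit_mask; congr (_ * _); apply: eq_bigr => k _.
by rewrite mulrDr (_ : k%:R * c%:~R = (k%:Z * c)%:~R) ?exDint // intrM -pmulrn.
Qed.

Lemma mask_poly_period N P x (c : int) : mask_poly N P (x + c%:~R) = mask_poly N P x.
Proof.
apply: eq_bigr => j _; rewrite mulrDr.
by rewrite (_ : (N ^ j)%:R * c%:~R = ((N ^ j)%:Z * c)%:~R) ?unit_mask_period // intrM -pmulrn.
Qed.

(** Parseval on the integers modulo [N]: expanding the square, the sum over [a] kills the terms with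
    [k != l], because [t] is invertible modulo [N]. *)
Lemma sum_nsq_unit_mask N t v : (0 < N)%N -> coprimez t N ->
  \sum_(a < N) nsq (unit_mask N (v + t%:~R * a%:R / N%:R)) = 1.
Proof.
move=> N0 ctN; have Nc := @natc_neq0 K _ N0; have Nr := @natr_neq0 K _ N0.
pose d (k l : 'I_N) : int := k%:Z - l%:Z.
have dE (k l : 'I_N) : (d k l)%:~R = k%:R - l%:R :> K by rewrite rmorphB.
have orth (k l : 'I_N) : \sum_(a < N) ex (a%:R * ((d k l)%:~R * t%:~R / N%:R)) =
    (N%:R *+ (k == l) : K[i]).
  rewrite sum_digits_ex //; have [->|kl] := eqVneq k l.
    rewrite /d subrr !mul0r; have -> : 0 = 0%:~R :> K by [].
    by rewrite unit_mask_int // mulr1.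
  rewrite (_ : unit_mask _ _ = 0) ?mulr0 //; apply/(unit_mask_eq0P _ N0).
  exists (d k l * t); last by rewrite intrM mulrC divfK.
  rewrite mulrC Gauss_dvdzr; last by rewrite coprimez_sym.
  apply: contra kl => /dvdzP[c dc]; apply/eqP/val_inj => /=.
  move: dc; rewrite /d; have := ltn_ord k; have := ltn_ord l => lN kN dc.
  have [c0|c0] := eqVneq c 0; first by move: dc; rewrite c0; lia.
  nia.
suff : (\sum_(a < N) nsq (unit_mask N (v + t%:~R * a%:R / N%:R))) +i* 0 = 1 :> K[i] by case.
rewrite cR_sum; under eq_bigr => a _.
  have -> : nsq (unit_mask N (v + t%:~R * a%:R / N%:R)) +i* 0 =
    \sum_(k < N) \sum_(l < N) N%:R^-1 * N%:R^-1 * ex ((d k l)%:~R * v) *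
       ex (a%:R * ((d k l)%:~R * t%:~R / N%:R)) :> K[i].
    rewrite nsqE /unit_mask conjc_mul conjc_sum.
    have -> : conjc (N%:R^-1 : K[i]) = N%:R^-1.
      by rewrite conjc_inv conjc_nat.
    rewrite mulrACA mulr_suml mulr_sumr; apply: eq_bigr => k _.
    rewrite mulr_sumr mulr_sumr; apply: eq_bigr => l _.
    rewrite -!mulrA -exN -!exD; congr (_ * (_ * ex _)); rewrite dE; ring.
  over.
rewrite exchange_big /= -[RHS](mulVf Nc) -[N in X in _ = _ * X]card_ord -sumr_const mulr_sumr.
apply: eq_bigr => k _; rewrite exchange_big /= (bigD1 k) //= [X in _ + X]big1 => [|l lk].
  rewrite -mulr_sumr orth eqxx mulr1n /d subrr mul0r ex0 addr0.
  by rewrite !mulr1 mulfVK.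
by rewrite -mulr_sumr orth eq_sym (negbTE lk) mulr0.
Qed.

(** The value is the term [a = 0] of the preceding sum of nonnegative terms, taken with [t = 1]. *)
Lemma nsq_unit_mask_le1 N x : (0 < N)%N -> nsq (unit_mask N x) <= 1.
Proof.
case: N => // N _; have := @sum_nsq_unit_mask N.+1 1 x isT.
rewrite big_ord_recl /= mulr0 mul0r addr0 => <-; last by rewrite coprimezE /= coprime1n.
by rewrite lerDl sumr_ge0 // => *; exact: nsq_ge0.
Qed.

Lemma nsq_prod (I : Type) (r : seq I) (F : I -> K[i]) :
  nsq (\prod_(i <- r) F i) = \prod_(i <- r) nsq (F i).
Proof.
elim: r => [|i r IH]; first by rewrite !big_nil nsq1.
by rewrite !big_cons nsqM IH.
Qed.

Lemma nsq_mask_poly_le1 N P x : (0 < N)%N -> nsq (mask_poly N P x) <= 1.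
Proof.
move=> N0; rewrite nsq_prod; elim: P => [|j P IH]; first by rewrite big_nil.
by rewrite big_cons mulr_ile1 ?nsq_ge0 ?nsq_unit_mask_le1 // prodr_ge0 // => *; exact: nsq_ge0.
Qed.

(* For M = R N^q and c a dual digit, R c / M is a sum of a_j / N^(j+1), j in P. *)
Fixpoint dual_digits (N q : nat) (P : seq nat) : seq nat :=
  if P is j :: P' then
    [seq (a * N ^ (q - j.+1) + c)%N | a <- iota 0 N, c <- dual_digits N q P']
  else [:: 0%N].

Lemma dual_digits0 N q P : (0 < N)%N -> 0%N \in dual_digits N q P.
Proof.
move=> N0; elim: P => //= j P IH; apply/allpairsP; exists (0%N, 0%N).
by rewrite mem_iota N0 IH.
Qed.

(** Induction on the exponents in increasing order. For a fixed tail [c], the leading digit [a] only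
    moves the factor of exponent [j], whose squares sum to 1. *)
Lemma sum_nsq_mask_poly N q P t u : (0 < N)%N -> coprimez t N -> sorted ltn P ->
  (forall j, j \in P -> (j < q)%N) ->
  \sum_(c <- dual_digits N q P) nsq (mask_poly N P (u + t%:~R * c%:R / (N ^ q)%:R)) = 1.
Proof.
move=> N0 ctN; have Npos i : (N ^ i)%:R != 0 :> K by rewrite natr_neq0 // expn_gt0 N0.
elim: P u => [|j P IH] u sP Pq; first by rewrite big_seq1 /mask_poly big_nil nsq1.
rewrite /= big_allpairs_dep /= exchange_big /=.
rewrite -[RHS](IH u (path_sorted sP)) => [|i iP]; last by apply: Pq; rewrite inE iP orbT.
apply: eq_bigr => c _.
have jq : (j < q)%N by apply: Pq; rewrite inE eqxx.
pose w := u + t%:~R * c%:R / (N ^ q)%:R.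
have aE a : u + t%:~R * (a * N ^ (q - j.+1) + c)%:R / (N ^ q)%:R =
    w + t%:~R * a%:R / (N ^ j.+1)%:R.
  rewrite /w natrD natrM mulrDr mulrDl addrA [u + _ + _]addrAC; congr (_ + _ + _).
  rewrite -{2}(subnK jq) expnD natrM.
  by field; rewrite ?Npos.
rewrite (eq_bigr (fun a => nsq (unit_mask N ((N ^ j)%:R * w + t%:~R * a%:R / N%:R)) *
    nsq (mask_poly N P w))) => [|a _]; last first.
  rewrite aE /mask_poly big_cons nsqM; congr (nsq _ * nsq _).
    congr unit_mask; rewrite mulrDr; congr (_ + _); rewrite expnS natrM.
    by field; rewrite ?Npos ?natr_neq0.
  apply: eq_big_seq => i iP.
  (* For [i > j] the shift [N ^ i * t * a / N ^ j.+1] is an integer, hence a period of the factor of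
     exponent [i]. *)
  have ji : (j < i)%N.
    by move: sP; rewrite /= path_sortedE; [move=> /andP[/allP /(_ _ iP)]|exact: ltn_trans].
  rewrite mulrDr (_ : (N ^ i)%:R * (t%:~R * a%:R / (N ^ j.+1)%:R) =
    ((N ^ (i - j.+1))%:Z * t * a%:Z)%:~R); first by rewrite unit_mask_period.
  rewrite !intrM -!pmulrn -{1}(subnK ji) expnD natrM.
  by field; rewrite ?Npos.
have -> : iota 0 N = index_iota 0 N by rewrite /index_iota subn0.
rewrite -mulr_suml big_mkord.
by rewrite sum_nsq_unit_mask // mul1r.
Qed.

End MaskSums.

(** * Integer translates avoiding the zeros for two multipliers at once *)

Section Avoidance.
Context {K : realType}.
Variables (mu : probability (measurableTypeR K) K) (N R q : nat) (P : seq nat).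
Hypotheses (N1 : (1 < N)%N) (R1 : (1 < R)%N) (cRN : coprime R N).
Hypothesis Pq : forall j, j \in P -> (j < q)%N.
Local Notation M := (R * N ^ q)%N.
Hypothesis ft_eq : forall y : K, ft mu y = mask_poly N P (y / M%:R) * ft mu (y / M%:R).
Implicit Types (x y : K) (n : nat) (t a z : int).

Let N0 : (0 < N)%N. Proof. exact: ltnW. Qed.

Definition is_int x := exists z, x = z%:~R.

Lemma ft_eq0_int y : ft mu y = 0 -> is_int y.
Proof.
move=> /(ft_eq0 N1 R1 Pq ft_eq)[k [j [b [_ _ _ ->]]]].
by exists ((R ^ k * N ^ (q * k - j.+1))%:Z * b); rewrite intrM -pmulrn.
Qed.

(** In a zero [a N^h = R^k N^c b], coprimality makes [R^k] divide [a], so [k <= |a|] and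
    [c <= q |a| < h]. The excess power of [N] must then divide [b], which is excluded. *)
Lemma ft_mul_expn_neq0 a h : a != 0 -> (q * `|a| < h)%N ->
  ft mu (a%:~R * (N ^ h)%:R) != 0.
Proof.
move=> a0 ah; apply/negP => /eqP /(ft_eq0 N1 R1 Pq ft_eq)[k [j [b [k0 jP Nb E]]]].
set c := (q * k - j.+1)%N in E.
have {}E : (`|a| * N ^ h = R ^ k * N ^ c * `|b|)%N.
  have : a * (N ^ h)%:Z = (R ^ k * N ^ c)%:Z * b.
    by apply/eqP; rewrite -(eqr_int K) !intrM -!pmulrn E.
  by move=> /(congr1 absz); rewrite !abszM.
have Ra : (R ^ k %| `|a|)%N.
  rewrite -(@Gauss_dvdl _ _ (N ^ h)); first by rewrite E -mulnA dvdn_mulr.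
  by rewrite coprimeXl // coprimeXr.
have ka : (k <= `|a|)%N.
  apply: leq_trans (dvdn_leq _ Ra); last by rewrite absz_gt0.
  by rewrite ltnW // ltn_expl.
have ch : (c < h)%N.
  apply: leq_ltn_trans ah; rewrite /c (leq_trans (leq_subr _ _)) //.
  by rewrite leq_mul2l ka orbT.
have : (N %| `|b|)%N.
  rewrite -(@Gauss_dvdr _ (R ^ k)); last by rewrite coprimeXr // coprime_sym.
  have Nc : (0 < N ^ c)%N by rewrite expn_gt0 N0.
  have -> : (R ^ k * `|b| = `|a| * N ^ (h - c))%N.
    apply/eqP; rewrite -(eqn_pmul2r Nc) -mulnA [(`|b| * _)%N]mulnC mulnA -E -mulnA.
    by rewrite -expnD subnK // ltnW.
  by rewrite dvdn_mull // -(subnKC ch) addSn subSn ?leq_addr // expnS dvdn_mulr.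
by move=> Nb'; case/negP: Nb; rewrite dvdzE.
Qed.

(** By Euler's theorem some large power of [N] is 1 modulo [t]; multiplying [a] by it stays in the
    class of [a] and lands on a point where [ft_mul_expn_neq0] applies. *)
Lemma ft_coset_neq0 t a : t != 0 -> coprimez t N -> exists z, ft mu (a + t * z)%:~R != 0.
Proof.
move=> t0 ctN; have [->|a0] := eqVneq a 0.
  by exists 0; rewrite mulr0 addr0 ft0 oner_eq0.
(* A multiple of the totient, for the congruence, that exceeds [q * |a|], for the nonvanishing. *)
pose h := (totient `|t| * (q * `|a|).+1)%N.
have tN : (t %| (N ^ h)%:Z - 1)%Z.
  have Nh : (1 <= N ^ h)%N by rewrite expn_gt0 N0.
  rewrite (subzn Nh) dvdzE /= -eqn_mod_dvd // /h expnM -modnXm.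
  by rewrite cyclic.Euler_exp_totient ?modnXm ?exp1n // coprime_sym.
case/dvdzP: tN => z zE; exists (a * z).
have -> : a + t * (a * z) = a * (N ^ h)%:Z.
  have -> : (N ^ h)%:Z = z * t + 1 by rewrite -zE subrK.
  ring.
rewrite intrM -pmulrn ft_mul_expn_neq0 // (@leq_trans (q * `|a|).+1) //.
by rewrite /h leq_pmull // totient_gt0 absz_gt0.
Qed.

(** Only integers can be zeros. If neither [t1 x] nor [t2 x] is an integer, any [z] works; if
    exactly one is, it alone has to be steered by [ft_coset_neq0]; if both are, Bezout makes [x] an
    integer and it is moved to 0. *)
Lemma ft_common_translate t1 t2 x : t1 != 0 -> t2 != 0 ->
  coprimez t1 t2 -> coprimez t1 N -> coprimez t2 N ->
  exists z, ft mu (t1%:~R * (x + z%:~R)) != 0 /\ ft mu (t2%:~R * (x + z%:~R)) != 0.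
Proof.
move=> t10 t20 c12 c1 c2.
have nint y : ~ is_int y -> ft mu y != 0.
  by move=> ny; apply/negP => /eqP /ft_eq0_int.
have mixed t t' : t != 0 -> coprimez t N -> is_int (t%:~R * x) -> ~ is_int (t'%:~R * x) ->
    exists z, ft mu (t%:~R * (x + z%:~R)) != 0 /\ ft mu (t'%:~R * (x + z%:~R)) != 0.
  move=> t0 ct [a ax] nx; have [z za] := ft_coset_neq0 a t0 ct; exists z; split.
    by rewrite mulrDr ax -intrM -intrD.
  apply: nint => -[b bx]; apply: nx; exists (b - t' * z).
  by rewrite intrB intrM -bx; ring.
have [i1|i1] := pselect (is_int (t1%:~R * x)); have [i2|i2] := pselect (is_int (t2%:~R * x)).
- have [u [v uv]] := Bezoutz t1 t2; rewrite (eqP c12) in uv.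
  move: i1 i2 => [a ax] [b bx]; exists (- (u * a + v * b)).
  suff -> : x + (- (u * a + v * b))%:~R = 0 by rewrite !mulr0 ft0 oner_eq0.
  rewrite rmorphN /= intrD !intrM -ax -bx.
  have -> : u%:~R * (t1%:~R * x) + v%:~R * (t2%:~R * x) = (u * t1 + v * t2)%:~R * x.
    by rewrite intrD !intrM; ring.
  by rewrite uv mul1r subrr.
- exact: mixed.
- by have [z [z1 z2]] := mixed t2 t1 t20 c2 i2 i1; exists z.
- by exists 0; rewrite addr0; split; exact: nint.
Qed.

(** Continuity at a nonzero value. [eps] is both the tolerance on [eta] and the lower bound, and it
    varies jointly with [x'], as the covering form of compactness requires. *)
Lemma ft_locally_bounded_below t x z : ft mu (t%:~R * (x + z%:~R)) != 0 ->
  \forall x' \near x & eps \near (0 : K)^'+, forall eta, `|eta| <= eps ->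
    eps <= nsq (ft mu (t%:~R * (x' + z%:~R) + eta)).
Proof.
set y := t%:~R * _ => y0; set d := nsq (ft mu y).
have d0 : 0 < d.
  by rewrite lt_neqAle nsq_ge0 andbT eq_sym; apply: contra y0 => /eqP /nsq_eq0 ->.
have : \forall w \near y, d / 2 < nsq (ft mu w).
  by apply: (cvgr_gt d (@continuous_nsq_ft _ mu y)); rewrite ltr_pdivrMr //; lra.
move=> /nbhs_ballP[r /= r0 rd].
have T0 : 0 < `|t%:~R : K| + 1 by rewrite ltr_wpDl.
pose U := ball x (r / 2 / (`|t%:~R| + 1)).
pose V : set K := [set eps | 0 < eps < Num.min (r / 2) (d / 2)].
exists (U, V).
  split => /=; first by apply: nbhsx_ballx; rewrite !divr_gt0.
  have m0 : 0 < Num.min (r / 2) (d / 2) by rewrite lt_min !divr_gt0.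
  near=> e; apply/andP; split; near: e; [exact: nbhs_right_gt|exact: nbhs_right_lt].
move=> [x' e] /= [xx' /andP[e0]]; rewrite lt_min => /andP[er ed] eta etae.
apply: ltW; apply: (lt_trans ed); apply: rd; rewrite /ball /=.
have -> : y - (t%:~R * (x' + z%:~R) + eta) = t%:~R * (x - x') - eta by rewrite /y; ring.
apply: (le_lt_trans (ler_normB _ _)); rewrite normrM.
have : `|t%:~R| * `|x - x'| <= r / 2.
  move: xx'; rewrite /U /ball /= ltr_pdivlMr // => /ltW; apply: le_trans.
  by rewrite mulrC ler_wpM2l // lerDl.
lra.
Unshelve. all: by end_near.
Qed.

(** Compactness of [[0, 1]] gives a common [eps]; the integer part of [x] is absorbed into [z]. *)
Lemma ft_uniform_translate t1 t2 : t1 != 0 -> t2 != 0 ->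
  coprimez t1 t2 -> coprimez t1 N -> coprimez t2 N ->
  exists2 eps : K, 0 < eps & forall x, exists z, forall eta, `|eta| <= eps ->
    eps <= nsq (ft mu (t1%:~R * (x + z%:~R) + eta)) /\
    eps <= nsq (ft mu (t2%:~R * (x + z%:~R) + eta)).
Proof.
move=> t10 t20 c12 c1 c2.
pose Q (eps x : K) := exists z, forall eta, `|eta| <= eps ->
    eps <= nsq (ft mu (t1%:~R * (x + z%:~R) + eta)) /\
    eps <= nsq (ft mu (t2%:~R * (x + z%:~R) + eta)).
have : \forall eps \near (0 : K)^'+, `[0, 1] `<=` Q eps.
  have cov := proj1 (compact_near_coveringP _) (@segment_compact K 0 1).
  apply: (cov K (0^'+) Q) => x _.
  have [z [z1 z2]] := ft_common_translate x t10 t20 c12 c1 c2.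
  have n1 := ft_locally_bounded_below z1; have n2 := ft_locally_bounded_below z2.
  by apply: filterS2 n1 n2 => -[x' e] /= h1 h2; exists z => eta etae; split; [exact: h1|exact: h2].
move=> nQ; have [e [e0 eQ]] : exists e, 0 < e /\ `[0, 1] `<=` Q e.
  have : \forall e \near (0 : K)^'+, 0 < e /\ `[0, 1] `<=` Q e.
    by apply: filterI nQ; exact: nbhs_right_gt.
  by move=> /filter_ex.
exists e => // x; pose f := x - (Num.floor x)%:~R.
have [|z zQ] := eQ f.
  rewrite /= in_itv /= subr_ge0 floor_le_tmp /= lerBlDl -intrD1.
  by rewrite ltW // floorD1_gt.
by exists (z - Num.floor x) => eta /zQ; rewrite intrB (addrC z%:~R) addrA.
Qed.

End Avoidance.

(** * The tree of integers whose dilates are spectra *)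

Section SpectralTree.
Context {K : realType}.
Variables (mu : probability (measurableTypeR K) K) (N R q : nat) (P : seq nat).
Hypotheses (N1 : (1 < N)%N) (R1 : (1 < R)%N).
Hypotheses (sP : sorted ltn P) (Pq : forall j, j \in P -> (j < q)%N).
Local Notation M := (R * N ^ q)%N.
Hypothesis ft_eq : forall y : K, ft mu y = mask_poly N P (y / M%:R) * ft mu (y / M%:R).
Implicit Types (x y : K) (n m : nat) (t l z : int).

Let N0 : (0 < N)%N. Proof. exact: ltnW. Qed.
Let R0 : (0 < R)%N. Proof. exact: ltnW. Qed.
Let M0 : (0 < M)%N. Proof. by rewrite muln_gt0 R0 expn_gt0 N0. Qed.
Let Mn0 n : (M ^ n)%:R != 0 :> K. Proof. by rewrite natr_neq0 // expn_gt0 M0. Qed.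

Local Notation imask := (@iter_mask K N R q P).

Lemma iter_mask0 n : imask n 0 = 1.
Proof.
rewrite /iter_mask big1 // => k _; rewrite mul0r /mask_poly big1_seq // => j _.
by rewrite mulr0 -[0]/(0%:~R) unit_mask_int.
Qed.

Lemma iter_mask_period n y z : imask n (y + (M ^ n)%:R * z%:~R) = imask n y.
Proof.
apply: eq_bigr => k _; rewrite mulrDl.
have kn : (k.+1 <= n)%N by [].
rewrite (_ : (M ^ n)%:R * z%:~R / (M ^ k.+1)%:R = ((M ^ (n - k.+1))%:Z * z)%:~R).
  by rewrite mask_poly_period.
rewrite intrM -pmulrn -{1}(subnK kn) expnD natrM.
by have := Mn0 k.+1; move: (_%:R) (_%:R) => u v u0; field.
Qed.

Lemma nsq_iter_mask_le1 n y : nsq (imask n y) <= 1.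
Proof.
rewrite nsq_prod.
suff /andP[] : 0 <= \prod_(k < n) nsq (mask_poly N P (y / (M ^ k.+1)%:R)) <= 1 by [].
elim/big_ind: _ => [|a b /andP[a0 a1] /andP[b0 b1]|k _]; first by rewrite ler01 lexx.
  by rewrite mulr_ge0 // mulr_ile1.
by rewrite nsq_ge0 nsq_mask_poly_le1.
Qed.

Lemma nsq_ft_le_iter_mask n y : nsq (ft mu y) <= nsq (imask n y).
Proof.
rewrite (ft_iter_mask ft_eq n y) nsqM -[leRHS]mulr1.
by rewrite ler_wpM2l ?nsq_ge0 ?nsq_ft_le1.
Qed.

Lemma nsq_ft_le_div n y : nsq (ft mu y) <= nsq (ft mu (y / (M ^ n)%:R)).
Proof.
rewrite {1}(ft_iter_mask ft_eq n y) nsqM -[leRHS]mul1r.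
by rewrite ler_wpM2r ?nsq_ge0 ?nsq_iter_mask_le1.
Qed.

(* zs x is the integer by which x is translated away from the zeros of the Fourier
   transform; the digit 0 is left alone, so that the tree increases. *)
Variable zs : K -> int.

Definition shift n l (c : nat) : int :=
  if c == 0%N then 0 else zs ((l%:~R + (M ^ n * (R * c))%:R) / (M ^ n.+1)%:R).

(** The correction adds a multiple of [M ^ n.+1], which is a period of the first [n.+1] mask
    factors, so it affects only the tail of the infinite product. *)
Definition child n l (c : nat) : int :=
  l + (M ^ n)%:Z * ((R * c)%:Z + M%:Z * shift n l c).

Local Notation ddigits := (dual_digits N q P).

Fixpoint tree n : seq int :=
  if n is n'.+1 then [seq child n' l c | l <- tree n', c <- ddigits] else [:: 0].

(** A new digit leaves the first [n] factors unchanged. In the next one the factor [R] of [R * c]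
    cancels against [M = R N^q], leaving the shift [t c / N^q] of [sum_nsq_mask_poly]. *)
Lemma sum_nsq_iter_mask n t x : coprimez t N ->
  \sum_(l <- tree n) nsq (imask n (x + t%:~R * l%:~R)) = 1.
Proof.
move=> ct; elim: n => [|n IH].
  by rewrite big_seq1 /iter_mask big_ord0 nsq1.
rewrite /= big_allpairs_dep /= -[RHS]IH; apply: eq_bigr => l _.
set y := x + t%:~R * l%:~R.
rewrite (eq_bigr (fun c => nsq (imask n y) * nsq (mask_poly N P
    (y / (M ^ n.+1)%:R + t%:~R * c%:R / (N ^ q)%:R)))) => [|c _].
  by rewrite -mulr_sumr sum_nsq_mask_poly // mulr1.
have yE : x + t%:~R * (child n l c)%:~R =
    y + (M ^ n)%:R * (t * ((R * c)%:Z + M%:Z * shift n l c))%:~R.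
  by rewrite /child intrD [in LHS]intrM -pmulrn [(t * _)%:~R]intrM /y; ring.
rewrite {1}/iter_mask big_ord_recr -/(iter_mask N R q P n _) nsqM yE iter_mask_period.
congr (_ * nsq _); rewrite -(mask_poly_period _ _ (_ + _) (t * shift n l c)).
congr mask_poly; have Nq : (N ^ q)%:R != 0 :> K by rewrite natr_neq0 // expn_gt0 N0.
have Rr := @natr_neq0 K _ R0; have := Mn0 n.
rewrite expnSr !natrM !intrM intrD intrM -!pmulrn !natrM.
by move=> *; field; rewrite ?Rr ?Nq.
Qed.

Lemma tree_child0 n l : child n l 0 = l.
Proof. by rewrite /child /shift eqxx muln0 mulr0 addr0 mulr0 addr0. Qed.

Lemma tree_subset n m : (n <= m)%N -> {subset tree n <= tree m}.
Proof.
move=> /subnK <-; elim: (m - n)%N => // k IH l /IH lk.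
rewrite addSn /=; apply/allpairsP; exists (l, 0%N).
by rewrite /= tree_child0 dual_digits0.
Qed.

(* The term l = l0 of sum_nsq_iter_mask already equals 1, so the others vanish. *)
Lemma tree_rem n t l0 l : coprimez t N -> l0 \in tree n -> l \in rem l0 (tree n) ->
  imask n (t%:~R * (l%:~R - l0%:~R)) = 0.
Proof.
move=> ct l0T lT; have := sum_nsq_iter_mask n (- (t%:~R * l0%:~R)) ct.
rewrite (perm_big _ (perm_to_rem l0T)) big_cons addNr iter_mask0 nsq1.
move/eqP; rewrite -subr_eq0 addrAC subrr add0r (perm_big _ (perm_to_rem lT)) big_cons.
rewrite paddr_eq0 ?nsq_ge0 ?sumr_ge0 // => [/andP[/eqP /nsq_eq0 <- _]|i _]; last exact: nsq_ge0.
by congr (imask n _); ring.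
Qed.

(** A repeated [l] would, by [tree_rem] with [t = 1], make [iter_mask n 0] vanish, but its value is
    1. *)
Lemma tree_uniq n : uniq (tree n).
Proof.
apply: count_mem_uniq => l; have [lT|lT] := boolP (l \in tree n); last first.
  by apply/count_memPn.
have := perm_to_rem lT => /permP ->; rewrite /= eqxx.
suff /count_memPn -> : l \notin rem l (tree n) by [].
apply/negP => lr; have := @tree_rem n 1 l l _ lT lr.
have c1 : coprimez 1 N by rewrite coprimezE /= coprime1n.
rewrite subrr mulr0 iter_mask0 => /(_ c1) /eqP.
by rewrite oner_eq0.
Qed.

Lemma ft_tree_eq0 n t l l' : coprimez t N -> l \in tree n -> l' \in tree n -> l != l' ->
  ft mu (t%:~R * l%:~R - t%:~R * l'%:~R) = 0.
Proof.
move=> ct lT l'T ll'; rewrite -mulrBr (ft_iter_mask ft_eq n) tree_rem ?mul0r //.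
by rewrite mem_rem_uniq ?tree_uniq // inE ll'.
Qed.

Definition tree_set t : set K := [set t%:~R * l%:~R | l in [set l : int | exists n, l \in tree n]].

Variables (t : int) (eps : K).
Hypotheses (ct : coprimez t N) (eps0 : 0 < eps).
Hypothesis ft_lower : forall x eta, `|eta| <= eps ->
  eps <= nsq (ft mu (t%:~R * (x + (zs x)%:~R) + eta)).

(** The level [k] is that of the last nonzero digit of [l]: there [l / M ^ k] is exactly a point
    translated by [zs], so [ft_lower] applies. Later zero digits do not change [l]. *)
Lemma tree_late n m l : l \in tree n -> l \notin tree m -> exists k,
  [/\ (m <= k)%N, (k <= n)%N & forall eta, `|eta| <= eps ->
      eps <= nsq (ft mu (t%:~R * l%:~R / (M ^ k)%:R + eta))].
Proof.
elim: n => [|n IH]; first by move=> l0; rewrite (tree_subset (leq0n m) l0).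
move=> lT lm; have /allpairsP[[l' c] [/= l'T cD lE]] := lT.
have [c0|c0] := eqVneq c 0%N.
  have l'l : l = l' by rewrite lE c0 tree_child0.
  have [|//|k [mk kn kE]] := IH; first by rewrite l'l.
  by exists k; split=> //; exact: leqW.
pose v : K := (l'%:~R + (M ^ n * (R * c))%:R) / (M ^ n.+1)%:R.
have lv : t%:~R * l%:~R / (M ^ n.+1)%:R = t%:~R * (v + (zs v)%:~R).
  rewrite -mulrA; congr (_ * _); rewrite lE /child /shift (negbTE c0) -/v.
  have -> : (l' + (M ^ n)%:Z * ((R * c)%:Z + M%:Z * zs v))%:~R =
      l'%:~R + (M ^ n * (R * c))%:R + (M ^ n.+1)%:R * (zs v)%:~R :> K.
    by rewrite !(intrD, intrM) -!pmulrn expnSr !(natrM _ (M ^ n)); ring.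
  by rewrite mulrDl mulrAC mulfV ?mul1r.
exists n.+1; split=> // [|eta etae]; last by rewrite lv ft_lower.
by rewrite leqNgt; apply/negP => nm; rewrite (tree_subset (ltnW nm) lT) in lm.
Qed.

(** The quotient of the two sides is governed by the tail [ft mu (_ / M ^ n)], which is no smaller
    in modulus than at level [k <= n]; there [x / M ^ k] acts as the perturbation [eta]. *)
Lemma iter_mask_le_ft n m l x : l \in tree n -> l \notin tree m ->
  `|x / (M ^ m)%:R| <= eps ->
  eps * nsq (imask n (x + t%:~R * l%:~R)) <= nsq (ft mu (x + t%:~R * l%:~R)).
Proof.
move=> ln lm xm; have [k [mk kn kE]] := tree_late ln lm.
rewrite (ft_iter_mask ft_eq n (_ + _)) nsqM mulrC ler_wpM2l ?nsq_ge0 //.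
have -> : (x + t%:~R * l%:~R) / (M ^ n)%:R =
    (x + t%:~R * l%:~R) / (M ^ k)%:R / (M ^ (n - k))%:R.
  by rewrite -{1}(subnKC kn) expnD natrM invfM mulrA.
apply: le_trans (nsq_ft_le_div _ _); rewrite mulrDl addrC; apply: kE.
apply: le_trans xm; rewrite !normrM ler_wpM2l // !ger0_norm ?invr_ge0 //.
by rewrite lef_pV2 ?posrE ?ltr0n ?expn_gt0 ?M0 // ler_nat leq_pexp2l.
Qed.

(** At a deep level [n] the masses [A] on [tree m] and [B] off it add up to 1. The first is almost
    [S m] since the tails are close to 1, and the second is at most [(S n - S m) / eps], which is
    small because [S] converges. *)
Lemma tree_parseval x delta : 0 < delta ->
  exists n, 1 - delta < \sum_(l <- tree n) nsq (ft mu (x + t%:~R * l%:~R)).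
Proof.
move=> d0; pose S n := \sum_(l <- tree n) nsq (ft mu (x + t%:~R * l%:~R)).
have S1 n : S n <= 1.
  by rewrite -(sum_nsq_iter_mask n x ct); apply: ler_sum => l _; exact: nsq_ft_le_iter_mask.
have bigSplit n m (F : int -> K) : (n <= m)%N -> \sum_(l <- tree m) F l =
    \sum_(l <- tree n) F l + \sum_(l <- tree m | l \notin tree n) F l.
  move=> nm; rewrite (bigID (fun l => l \in tree n)) /=; congr (_ + _).
  rewrite -big_filter; apply: perm_big; apply: uniq_perm.
  - by rewrite filter_uniq // tree_uniq.
  - exact: tree_uniq.
  - move=> l; rewrite mem_filter; case: (boolP (l \in tree n)) => //= lT.
    exact: tree_subset lT.
have Smono : {homo S : n m / (n <= m)%N >-> n <= m}.
  move=> n m nm; rewrite /S (bigSplit n m) // lerDl sumr_ge0 // => *; exact: nsq_ge0.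
have Scvg : cvgn S.
  by apply: nondecreasing_is_cvgn => //; exists 1 => _ [n _ <-].
(* Chosen so that [d + d / eps = delta / 2], the total loss from [A] and [B]. *)
pose d := delta * eps / (2 * (eps + 1)).
have e1 : 0 < eps + 1 by rewrite addr_gt0.
have dp : 0 < d by rewrite /d divr_gt0 ?mulr_gt0.
have [m [mx mS]] : exists m, `|x / (M ^ m)%:R| <= eps /\ limn S - d < S m.
  have near1 : \forall m \near \oo, `|x / (M ^ m)%:R| <= eps.
    by have := @cvg_div_expn K N R q N1 R1 x => /cvgr0_norm_le; apply.
  have near2 : \forall m \near \oo, limn S - d < S m.
    by apply: (cvgr_gt _ Scvg); lra.
  have := filterI near1 near2; move=> [m _ /(_ m (leqnn m)) [h1 h2]].
  by exists m.
have nearF (s : seq int) : \forall n \near \oo,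
    {in s, forall l, 1 - d <= nsq (ft mu ((x + t%:~R * l%:~R) / (M ^ n)%:R))}.
  elim: s => [|l s IH]; first by apply: nearW.
  have nl : \forall n \near \oo, 1 - d <= nsq (ft mu ((x + t%:~R * l%:~R) / (M ^ n)%:R)).
    by apply: (cvgr_ge _ (@cvg_ft_div_expn K mu N R q N1 R1 _)); lra.
  apply: filterS2 nl IH => n nl ns k; rewrite inE => /orP[/eqP ->//|]; exact: ns.
have [n [mn nF]] : exists n, (m <= n)%N /\
    {in tree m, forall l, 1 - d <= nsq (ft mu ((x + t%:~R * l%:~R) / (M ^ n)%:R))}.
  have := filterI (nbhs_infty_ge m) (nearF (tree m)).
  by move=> [n _ /(_ n (leqnn n)) [h1 h2]]; exists n.
exists m; rewrite -/(S m).
have Sn : S n <= limn S by apply: nondecreasing_cvgn_le.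
have tail : eps * \sum_(l <- tree n | l \notin tree m) nsq (imask n (x + t%:~R * l%:~R))
    <= S n - S m.
  rewrite /S (bigSplit m n) // addrAC subrr add0r mulr_sumr.
  rewrite big_seq_cond [leRHS]big_seq_cond; apply: ler_sum => l /andP[ln lm].
  exact: (iter_mask_le_ft ln lm).
have head : (1 - d) * \sum_(l <- tree m) nsq (imask n (x + t%:~R * l%:~R)) <= S m.
  rewrite mulr_sumr big_seq [leRHS]big_seq; apply: ler_sum => l lT.
  rewrite (ft_iter_mask ft_eq n (_ + _)) nsqM mulrC ler_wpM2l ?nsq_ge0 //; exact: nF.
have := sum_nsq_iter_mask n x ct; rewrite (bigSplit m n) //.
move: tail head; set A := \sum_(l <- tree m) _; set B := \sum_(l <- tree n | _) _.
have A0 : 0 <= A by apply: sumr_ge0 => *; exact: nsq_ge0.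
have B0 : 0 <= B by apply: sumr_ge0 => *; exact: nsq_ge0.
move=> tail head AB.
have B1 : eps * B < d by lra.
have B2 : B < d / eps by rewrite ltr_pdivlMr // mulrC.
have A1 : (1 - d) * A = A - d * A by ring.
have A2 : d * A <= d by rewrite -[leRHS]mulr1 ler_wpM2l //; lra.
have dE : d + d / eps = delta / 2.
  rewrite /d; field; rewrite gt_eqF //=; lra.
lra.
Qed.

Lemma tree_spectrum : t != 0 -> spectrum mu (tree_set t).
Proof.
move=> t0; have tr0 : t%:~R != 0 :> K by rewrite intr_eq0.
apply: spectrum_of_parseval.
- by apply: (sub_countable (card_image_le _ _)); exact: countableP.
- move=> _ _ [l [n lT] <-] [l' [n' l'T] <-] ll'.
  apply: (@ft_tree_eq0 (maxn n n')) => //.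
  + exact: tree_subset (leq_maxl _ _) _ lT.
  + exact: tree_subset (leq_maxr _ _) _ l'T.
  + by apply: contraNneq ll' => ->.
(* The tree sum is taken at [- x]: Parseval involves [x - t l], and the squared modulus of [ft mu]
   is even. *)
move=> x e e0; have [n nE] := tree_parseval (- x) e0.
exists [seq t%:~R * l%:~R | l <- tree n]; split.
- rewrite map_inj_in_uniq ?tree_uniq // => l l' _ _ /(mulfI tr0) /eqP.
  by rewrite eqr_int => /eqP.
- by move=> _ /mapP[l lT ->]; exists l => //; exists n.
rewrite big_map; apply: lt_le_trans nE _; apply: ler_sum => l _.
have -> : x - t%:~R * l%:~R = - (- x + t%:~R * l%:~R) by ring.
by rewrite ftN nsq_conj.
Qed.

End SpectralTree.

(** * Specialisation to the given digit set, and the equivalence *)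

Lemma ft_digit_set (K : realType) (s R N q : nat) (p : 'I_s -> nat)
    (mu : probability (measurableTypeR K) K) : (1 < N)%N ->
  (forall i, 0 < p i)%N -> (forall i j : 'I_s, (i < j)%N -> (p i < p j)%N) ->
  self_similar (R * N ^ q) (digit_set N p) mu -> forall y : K,
  ft mu y = mask_poly N (0%N :: codom p) (y / (R * N ^ q)%:R) * ft mu (y / (R * N ^ q)%:R).
Proof.
move=> N1 p0 pinc muS y; have cD := card_digit_set N1 p0 pinc.
have D0 : (0 < #|` digit_set N p|)%N by rewrite cD expn_gt0 ltnW.
rewrite {1}(ft_self_similar D0 muS) sum_digit_set // cD natrX mulKf //.
by rewrite expf_neq0 // natc_neq0 // ltnW.
Qed.

Lemma sorted_codom (s : nat) (p : 'I_s -> nat) : (forall i, 0 < p i)%N ->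
  (forall i j : 'I_s, (i < j)%N -> (p i < p j)%N) -> sorted ltn (0%N :: codom p).
Proof.
move=> p0 pinc; rewrite /= path_sortedE; last exact: ltn_trans.
apply/andP; split; first by apply/allP => _ /codomP[i ->]; exact: p0.
rewrite /codom /image_mem sorted_map.
have : sorted ltn [seq val i | i <- enum 'I_s] by rewrite val_enum_ord iota_ltn_sorted.
by rewrite sorted_map; apply: sub_sorted => i j; exact: pinc.
Qed.

Lemma codom_max (s : nat) (p : 'I_s -> nat) : (1 <= s)%N ->
  (forall i j : 'I_s, (i < j)%N -> (p i < p j)%N) ->
  exists2 pm, pm \in 0%N :: codom p & forall j, j \in 0%N :: codom p -> (j <= pm)%N.
Proof.
case: s p => // n p _ pinc; exists (p ord_max); first by rewrite inE codom_f orbT.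
move=> j; rewrite inE => /orP[/eqP ->//|/codomP[i ->]].
have [->//|im] := eqVneq i ord_max; apply: ltnW; apply: pinc.
by rewrite ltn_neqAle -ltnS ltn_ord andbT; apply: contra im => /eqP e; apply/eqP/val_inj.
Qed.

Theorem theorem1p3 (K : realType) (s R N q : nat) (p : 'I_s -> nat)
    (s_ge1 : (1 <= s)%N) (R_gt1 : (1 < R)%N) (N_gt1 : (1 < N)%N)
    (q_gt0 : (0 < q)%N) (p_gt0 : forall i, (0 < p i)%N)
    (RN_coprime : coprime R N)
    (p_incr : forall i j : 'I_s, (i < j)%N -> (p i < p j)%N)
    (p_lt_q : forall i, (p i < q)%N)
    (mu : probability (measurableTypeR K) K)
    (mu_self_similar : self_similar (R * N ^ q) (digit_set N p) mu)
    (t : K) :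
  (exists L : set K, spectrum mu L /\ spectrum mu [set t * x | x in L]) <->
  (exists t1 t2 : int,
    [/\ t = t1%:~R / t2%:~R, coprimez t1 t2, coprimez t1 N & coprimez t2 N]).
Proof.
pose P := 0%N :: codom p.
have ft_eq := ft_digit_set N_gt1 p_gt0 p_incr mu_self_similar.
have Pq j : j \in P -> (j < q)%N by rewrite inE => /orP[/eqP ->//|/codomP[i ->]].
have [pm pmP Ppm] : exists2 pm, pm \in P & forall j, j \in P -> (j <= pm)%N.
  exact: codom_max.
split=> [[L [sL stL]]|[t1 [t2 [tE c12 c1 c2]]]].
  exact: (spectra_ratio N_gt1 R_gt1 Pq pmP Ppm ft_eq sL stL).
have nz u : coprimez u N -> u != 0.
  by apply: contraTneq => ->; rewrite coprimezE /= /coprime gcd0n neq_ltn N_gt1 orbT.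
have [t10 t20] : t1 != 0 /\ t2 != 0 by split; exact: nz.
have [eps eps0 trans] := ft_uniform_translate N_gt1 R_gt1 RN_coprime Pq ft_eq t10 t20 c12 c1 c2.
(* A single choice of translations serves both [t1] and [t2], so one tree yields both spectra. *)
have [zs zsE] := choice trans.
have sP := sorted_codom p_gt0 p_incr.
have sp u : coprimez u N -> (forall x eta : K, `|eta| <= eps ->
    eps <= nsq (ft mu (u%:~R * (x + (zs x)%:~R) + eta))) ->
    spectrum mu (tree_set N R q P zs u).
  by move=> cu uE; exact: (tree_spectrum N_gt1 R_gt1 sP Pq ft_eq cu eps0 uE (nz _ cu)).
(* The witness is the dilate by [t2]; multiplication by [t = t1 / t2] turns it into the dilate by
   [t1]. *)
exists (tree_set N R q P zs t2); split.
  by apply: (sp t2 c2) => x eta H; have [] := zsE x eta H.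
suff -> : [set t * x | x in tree_set N R q P zs t2] = tree_set N R q P zs t1.
  by apply: (sp t1 c1) => x eta H; have [] := zsE x eta H.
have t2r0 : t2%:~R != 0 :> K by rewrite intr_eq0.
have tl (l : int) : t * (t2%:~R * l%:~R) = t1%:~R * l%:~R.
  by rewrite tE mulrA divfK.
apply/seteqP; split=> [_ [_ [l lT <-] <-]|_ [l lT <-]]; first by exists l; rewrite ?tl.
by exists (t2%:~R * l%:~R); rewrite ?tl //; exists l.
Qed.
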